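(* Let $p\in[1,\infty)$ and let $(X,d,\mu)$ be a locally complete and separable metric measure space, where $\mu$ is a Borel measure on $X$ with $0<\mu(B)<\infty$ for every ball $B=B(x,r)$, $x\in X$, $0<r<\infty$. Let $E\subset X$ be any set. Then $$\mathrm{Cap}_p(E)=\inf_{E\subset O}\mathrm{Cap}_p(O),$$ where the infimum is taken over all open subsets $O$ of $X$ containing $E$.
   Context: A metric space is locally complete if every point has a neighborhood that is complete in the restricted metric (equivalently, $X$ is an open subset of its completion). For a rectifiable curve $\gamma$, $\int_\gamma g\,ds$ is the usual path integral, defined via the constant-speed parametrization of $\gamma$ on $[0,1]$. A Borel function $g:X\to[0,\infty]$ is an upper gradient of $f:X\to[-\infty,\infty]$ if for all rectifiable curves $\gamma:[0,1]\to X$ one has $|f(\gamma(1))-f(\gamma(0))|\le\int_\gamma g\,ds$, where the left-hand side is interpreted as $\infty$ if it has the form $|\infty-\infty|$ or $|-\infty-(-\infty)|$. Let $\mathcal D(f)$ be the set of upper gradients of $f$. $N^{1,p}(X)$ is the collection of all (pointwise defined) functions $f\in L^p(X)$ that have an upper gradient $g\in L^p(X)$, with seminorm $$\|f\|_{N^{1,p}(X)}=\Big(\|f\|_{L^p(X)}^p+\inf_{g\in\mathcal D(f)}\|g\|_{L^p(X)}^p\Big)^{1/p}.$$ For $E\subset X$, $\mathrm{Cap}_p(E)=\inf\{\|u\|_{N^{1,p}(X)}^p : u\in N^{1,p}(X),\ u|_E\ge 1\}$ (with $\inf\emptyset=\infty$). *)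

(* Defs.v *)
From HB Require Import structures.
From mathcomp Require Import all_boot all_order all_algebra.
From mathcomp Require Import all_classical all_reals all_analysis.
From mathcomp Require Import measurable_realfun.

Set Implicit Arguments.
Unset Strict Implicit.
Unset Printing Implicit Defensive.

Import Order.TTheory GRing.Theory Num.Theory.
Import numFieldNormedType.Exports.

Local Open Scope classical_set_scope.
Local Open Scope ring_scope.

(* A measurableType is pointed, so the metric space has to be pointed too; this
   only excludes the empty space. *)
#[short(type="pmetricType")]
HB.structure Definition PointedMetric (K : numDomainType) :=
  {T of Metric K T & isPointed T}.

Definition borel (T : ptopologicalType) := g_sigma_algebraType (@open T).

Section MetricSpace.
Context {R : realType} {X : pmetricType R}.

Definition complete_subset (A : set X) : Prop :=
  forall u : nat -> X, (forall n, A (u n)) -> cauchy (u @ \oo) ->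
    exists2 x, A x & u @ \oo --> x.

Definition locally_complete : Prop :=
  forall x : X, exists2 A : set X, nbhs x A & complete_subset A.

Definition separable_space : Prop :=
  exists2 D : set X, countable D & dense D.

(* Curves are maps on R of which only the restriction to [0, 1] matters. *)
Implicit Type c : R -> X.

Definition curve_variation (a b : R) c (s : seq R) : R :=
  \sum_(i < size s) mdist (c (nth b (a :: s) i)) (c (nth b s i)).

Definition curve_length (a b : R) c : \bar R :=
  ereal_sup [set (curve_variation a b c s)%:E | s in itv_partition a b].

Definition rectifiable c : Prop :=
  {within `[0, 1], continuous c} /\ (curve_length 0 1 c < +oo)%E.

(* The constant-speed parametrization of a rectifiable curve c of length L maps
   u to c t for any t such that c restricted to [0, t] has length u * L; it
   does not depend on the choice of t, see const_speedE. *)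
Definition const_speed c (u : R) : X :=
  c (xget 0 [set t | t \in `[0, 1] /\
                     curve_length 0 t c = (u%:E * curve_length 0 1 c)%E]).

(* When c is constant the value is 0, even if the integral on [0, 1] is +oo,
   because 0 * +oo = 0 in \bar R. *)
Definition path_integral (g : X -> \bar R) c : \bar R :=
  (curve_length 0 1 c *
   \int[lebesgue_measure]_(t in `[0%R, 1%R]) g (const_speed c t))%E.

(* In \bar R both +oo - +oo and -oo - -oo are equal to -oo, whose absolute
   value is +oo. *)
Definition upper_gradients (f : X -> \bar R) : set (X -> \bar R) :=
  [set g : X -> \bar R |
    [/\ measurable_fun [set: borel X] g,
        forall x, (0 <= g x)%E &
        forall c, rectifiable c ->
          (`|f (c 1%R) - f (c 0%R)| <= path_integral g c)%E]].

End MetricSpace.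
Arguments locally_complete {R} X.
Arguments separable_space {R} X.

Section ConstSpeed.
Context {R : realType} {X : pmetricType R}.
Implicit Type c : R -> X.

Lemma curve_length_ge (s t : R) c : 0 <= s -> s < t ->
  (curve_length 0 s c + (mdist (c s) (c t))%:E <= curve_length 0 t c)%E.
Proof.
move=> s0 st; rewrite -leeBrDr//; apply: ge_ereal_sup => _ [l [pl ll] <-].
rewrite leeBrDr// -EFinD; apply: ereal_sup_ubound; exists (rcons l t).
  by split; rewrite ?rcons_path ?last_rcons ?eqxx// pl (eqP ll).
congr EFin; rewrite /curve_variation size_rcons big_ord_recr/=; congr (_ + _).
  apply: eq_bigr => i _; rewrite -rcons_cons !nth_rcons/= ltnS ltnW ?ltn_ord//.
  by congr (mdist (c _) (c _)); apply: set_nth_default => //=; rewrite ltnS ltnW.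
rewrite -rcons_cons !nth_rcons/= ltnSn ltnn eqxx.
by rewrite -[in nth _ _ _]/(size (0 :: l)).-1 nth_last/= (eqP ll).
Qed.

Lemma const_speedE c (t u : R) : rectifiable c -> t \in `[0, 1] ->
  curve_length 0 t c = (u%:E * curve_length 0 1 c)%E -> const_speed c u = c t.
Proof.
move=> [_ cfin] t01 ct; rewrite /const_speed; case: xgetP => [s _ [s01 cs]|].
  have H x y : x \in `[0, 1] -> y \in `[0, 1] -> x < y ->
      curve_length 0 x c = curve_length 0 y c -> c x = c y.
    rewrite !in_itv/= => /andP[x0 x1] /andP[y0 y1] xy e.
    have := curve_length_ge c x0 xy; rewrite -e.
    have ge0 z : 0 <= z -> (0 <= curve_length 0 z c)%E.
      rewrite le_eqVlt => /predU1P[<-|z0].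
        apply: ereal_sup_ubound; exists [::]; first by split.
        by rewrite /curve_variation big_ord0.
      apply: (@le_trans _ _ (mdist (c 0) (c z))%:E); first by rewrite lee_fin mdist_ge0.
      apply: ereal_sup_ubound; exists [:: z]; first by split; rewrite /= ?z0.
      by rewrite /curve_variation big_ord_recl big_ord0/= addr0.
    have fin : curve_length 0 x c \is a fin_num.
      rewrite ge0_fin_numE ?ge0//; move: x1; rewrite le_eqVlt => /predU1P[->//|x1].
      apply: le_lt_trans cfin; apply: le_trans (curve_length_ge c x0 x1).
      by rewrite leeDl// lee_fin mdist_ge0.
    rewrite -[leRHS]adde0 leeD2lE// lee_fin => d0; apply: mdist_positivity.
    by apply/eqP; rewrite eq_le d0 mdist_ge0.
  case: (ltgtP s t) => [st|ts|->//].
    by apply: H => //; rewrite cs ct.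
  by apply/esym/H => //; rewrite cs ct.
by move=> /(_ t); case; split.
Qed.

End ConstSpeed.

Section Newtonian.
Context {R : realType} {X : pmetricType R}.
Variables (mu : {measure set (borel X) -> \bar R}) (p : R).
Local Open Scope ereal_scope.
Implicit Type f : X -> \bar R.

(* Elements of L^p are measurable for the mu-completion of the Borel
   sigma-algebra. *)
Definition mu_measurable f : Prop :=
  forall Y : set (\bar R), measurable Y -> completed_algebra_gen mu (f @^-1` Y).

Definition in_Lp f : Prop := mu_measurable f /\ Lnorm mu p%:E f < +oo.

Definition newtonian f : Prop :=
  in_Lp f /\ exists2 g, upper_gradients f g & in_Lp g.

Definition newtonian_norm f : \bar R :=
  (Lnorm mu p%:E f `^ p +
   ereal_inf [set Lnorm mu p%:E g `^ p | g in upper_gradients f]) `^ p^-1.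

Definition Cap (E : set X) : \bar R :=
  ereal_inf [set newtonian_norm u `^ p |
    u in [set u | newtonian u /\ forall x, E x -> 1 <= u x]].

End Newtonian.

(* Main.v *)
From HB Require Import structures.
Require Import Defs.
From mathcomp Require Import all_boot all_order all_algebra.
From mathcomp Require Import all_classical all_reals all_analysis.
From mathcomp Require Import measurable_realfun.
From mathcomp Require Import ring lra.

(* Let [u] be a function with values in [0, 1] that is 1 on [E], with an upper
   gradient [g].  On a small ball whose closure is complete, choose a lower
   semicontinuous weight [G >= g] in L^p that is huge off finite unions of tiny
   balls, and a lower semicontinuous [phi >= u] close to [u] in measure.  The
   potential [w x], the infimum over curves issued from [x] of the value of [phi]
   at the end of the curve plus the integral of [G] along it, satisfies
   [u <= w <= phi] and has the upper gradient [G].  It is lower semicontinuous: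
   curves of bounded cost have bounded length and stay in a totally bounded set,
   so almost optimal curves subconverge, and the cost is lower semicontinuous by
   Fatou's lemma.  The sets where [w] exceeds a level are therefore open.

   To globalize, lower each local potential by a small [del]: it then exceeds [u]
   only on an open set [B] of small measure, on which [G] has small energy.  The
   supremum of [u] and of countably many such functions has an upper gradient
   equal to [g] up to a small error, and it is almost 1 on an open set that
   contains [E]. *)

Set Implicit Arguments.
Unset Strict Implicit.
Unset Printing Implicit Defensive.

Import Order.TTheory GRing.Theory Num.Theory.
Import numFieldNormedType.Exports.
Local Open Scope classical_set_scope.
Local Open Scope ring_scope.

(** * Outer regularity and lower semicontinuous majorants *)

(** An admissible function for the capacity is Borel only up to null sets, and neither doubling nor
    a Poincaré inequality is at hand to regularize it by averages. The open superlevel sets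
    therefore come from an optimal control problem, whose value function has the upper gradient [G]
    by construction. Its semicontinuity needs compactness of curves although balls need not be
    totally bounded; finiteness of the measure on a ball makes up for this, since all but little of
    the mass lies in finitely many tiny balls and the rest can be made expensive. Local completeness
    provides the limit curve; competitors can be stopped at the boundary of the ball because [phi]
    vanishes outside. The weight is fixed before [phi], because the exceptional set [B] has to be
    small for the measure [G ^ p mu] and not only for [mu]. Lowering by [del] would spoil the bound
    1 on [E], so [u] is first multiplied by [K = (1 + e) ^ (1 / p)], which multiplies the energies
    by [1 + e]. *)

Section MetricBorel.
Context {R : realType} {X : pmetricType R}.
Implicit Types (x y : X) (A O : set X).

Lemma mball_open x (r : R) : open (ball x r).
Proof.
rewrite openE => y; rewrite ballEmdist/= => xy.
apply/nbhs_ballP; exists (r - mdist x y); first by rewrite /= subr_gt0.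
move=> z; rewrite !ballEmdist/= => yz.
by rewrite (le_lt_trans (metric_triangle _ y _))// -ltrBrDl.
Qed.

Lemma borel_open O : open O -> measurable (O : set (borel X)).
Proof. by move=> oO; exact: sub_sigma_algebra. Qed.

Lemma borel_closed A : closed A -> measurable (A : set (borel X)).
Proof.
by move=> cA; rewrite -(setCK A); apply: measurableC; apply: borel_open; rewrite openC.
Qed.

Lemma lsc_borel (f : X -> \bar R) :
  (forall a : R, open [set x | a%:E < f x]%E) ->
  measurable_fun [set: borel X] f.
Proof.
move=> scif; apply: (measurability _ (ErealGenOInfty.measurableE R)).
move=> /= _ [_ [a ->]] <-; apply: measurableI => //; apply: borel_open.
by rewrite preimage_itvoy; exact: scif.
Qed.

Variable nu : {measure set (borel X) -> \bar R}.
Hypothesis nu_fin : (nu setT < +oo)%E.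
Local Open Scope ereal_scope.

Let nu_lt A : measurable (A : set (borel X)) -> nu A < +oo.
Proof. by move=> mA; apply: le_lt_trans nu_fin; apply: le_measure; rewrite ?inE. Qed.

Lemma bigcap_measure_lt (F : (set X)^nat) (e : R) : (0 < e)%R ->
  (forall i, measurable (F i : set (borel X))) -> nonincreasing_seq F ->
  nu (\bigcap_n F n) < e%:E -> exists n, nu (F n) < e%:E.
Proof.
move=> e0 mF niF Fe.
have cF := nonincreasing_cvg_mu (nu_lt (mF 0%N)) mF (bigcapT_measurable mF) niF.
have [n _ /(_ n (leqnn _)) nF] : \forall n \near \oo, nu (F n) < e%:E.
  have := cF [set y | y < e%:E]; apply.
  by apply: open_nbhs_nbhs; split => //; exact: open_ereal_lt_ereal.
by exists n.
Qed.

(** Approximation from both sides at once is stable under complements, so that the sets with this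
    property form a sigma-algebra. *)
Let regular A := measurable (A : set (borel X)) /\ forall e : R, (0 < e)%R ->
  exists F O, [/\ closed F, open O, F `<=` A, A `<=` O & nu (O `\` F) < e%:E].

Let regular_open O : open O -> regular O.
Proof.
move=> oO; split; first exact: borel_open.
(* [F n] consists of the points at distance at least [1 / n.+1] from the complement of [O]; these
   closed sets exhaust [O]. *)
move=> e e0; pose F (n : nat) := ~` (\bigcup_(y in ~` O) ball y (n.+1%:R^-1 : R)).
have cF n : closed (F n).
  by rewrite closedC; apply: bigcup_open => y _; exact: mball_open.
have FO n : F n `<=` O.
  move=> x Fx; apply: contrapT => nOx; apply: Fx; exists x => //.
  exact: ballxx.
have [n nFe] : exists n, nu (O `\` F n) < e%:E.
  apply: bigcap_measure_lt => //.
  - by move=> i; apply: measurableD; [exact: borel_open|exact: borel_closed].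
  - move=> m n mn; apply/subsetPset; apply: setDS => x Fx [y Oy yx]; apply: Fx.
    by exists y => //; apply: le_ball yx; rewrite lef_pV2 ?posrE// ler_nat.
  rewrite (_ : \bigcap_n _ = set0) ?measure0 ?lte_fin//.
  rewrite -subset0 => x H.
  have [Ox _] := H 0%N I.
  have /nbhs_ballP[d /= d0 dO] : nbhs x O by apply: open_nbhs_nbhs.
  have [n _ /(_ n (leqnn _)) nd] := near_infty_natSinv_lt (PosNum d0).
  have [_] := H n I; apply => -[y Oy] /ball_sym xy; apply: Oy; apply: dO.
  by apply: le_ball xy; exact: ltW.
by exists (F n), O; split.
Qed.

Let regularC A : regular A -> regular (~` A).
Proof.
move=> [mA rA]; split; first exact: measurableC.
move=> e e0; have [F [V [cF oV FA AV FVe]]] := rA e e0.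
exists (~` V), (~` F); split.
- by rewrite closedC.
- by rewrite openC.
- exact: subsetC.
- exact: subsetC.
- by rewrite setDE setCK setIC -setDE.
Qed.

Let regularU (A : (set X)^nat) : (forall n, regular (A n)) -> regular (\bigcup_n A n).
Proof.
move=> rA; split; first by apply: bigcupT_measurable => n; case: (rA n).
move=> e e0; have e2 : (0 < e / 2)%R by rewrite divr_gt0.
have /choice[F0 /choice[V FV]] : forall n, exists F O, [/\ closed F, open O,
    F `<=` A n, A n `<=` O & nu (O `\` F) < (e / 2 / (2 ^ n.+1)%:R)%:E].
  by move=> n; apply: (rA n).2; rewrite divr_gt0// ltr0n expn_gt0.
(* A countable union of closed sets need not be closed, so only finitely many inner sets are kept;
   the gap [G n] decreases to a set covered by the differences of [V i] and [F0 i]. *)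
pose G n := \bigcup_n V n `\` \big[setU/set0]_(i < n) F0 i.
have mV n : measurable (V n : set (borel X)).
  by apply: borel_open; case: (FV n).
have mF n : measurable (F0 n : set (borel X)).
  by apply: borel_closed; case: (FV n).
have [n Gn] : exists n, nu (G n) < e%:E.
  apply: bigcap_measure_lt => //.
  - move=> n; apply: measurableD; first exact: bigcupT_measurable.
    exact: bigsetU_measurable.
  - move=> m n mn; apply/subsetPset; apply: setDS.
    exact: subset_bigsetU.
  apply: (@le_lt_trans _ _ (e / 2)%:E); last first.
    by rewrite lte_fin ltr_pdivrMr// mulr_natr mulr2n ltrDl.
  apply: le_trans (epsilon_trick0 predT (ltW e2)).
  apply: (@le_trans _ _ (\sum_(n <oo) nu (V n `\` F0 n))); last first.
    by apply: lee_nneseries => // n _; apply: ltW; case: (FV n).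
  apply: measure_sigma_subadditive => //.
  - by move=> n; exact: measurableD.
  - apply: bigcapT_measurable => n; apply: measurableD; first exact: bigcupT_measurable.
    exact: bigsetU_measurable.
  move=> x xG; have [[n _ On] _] := xG 0%N I; exists n => //; split => // Fn.
  by have [_] := xG n.+1 I; apply; rewrite -bigcup_mkord; exists n => /=.
exists (\big[setU/set0]_(i < n) F0 i), (\bigcup_n V n); split => //.
- by apply: closed_bigsetU => i _; case: (FV i).
- by apply: bigcup_open => i _; case: (FV i).
- rewrite -bigcup_mkord => x [i _ Fi]; exists i => //.
  by have [_ _ + _ _] := FV i; exact.
- by apply: subset_bigcup => i _; case: (FV i).
Qed.

Lemma outer_regular A (e : R) : measurable (A : set (borel X)) -> (0 < e)%R ->
  exists O, [/\ open O, A `<=` O & nu (O `\` A) < e%:E].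
Proof.
move=> mA e0; have [_ /(_ _ e0)[F [V [cF oV FA AV VFe]]]] : regular A.
  apply: (@smallest_sub _ (sigma_algebra setT) (@open X) regular) mA.
    split; first exact/regular_open/open0.
      by move=> B rB; rewrite setTD; exact: regularC.
    exact: regularU.
  exact: regular_open.
exists V; split => //; apply: le_lt_trans VFe; apply: le_measure; rewrite ?inE.
- by apply: measurableD => //; exact: borel_open.
- by apply: measurableD; [exact: borel_open|exact: borel_closed].
- exact: setDS.
Qed.

End MetricBorel.

Section Density.
Context d (T : measurableType d) (R : realType).
Variables (mu : {measure set T -> \bar R}) (f : T -> \bar R).
Local Open Scope ereal_scope.

(** The measure [f mu]. The proofs are arguments so that the measure structure can be attached to
    the term itself. *)
Definition density of measurable_fun setT f & (forall x, 0 <= f x) :=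
  fun A : set T => \int[mu]_(x in A) f x.

Hypotheses (mf : measurable_fun setT f) (f_ge0 : forall x, 0 <= f x).
Local Notation nu := (density mf f_ge0).

Let nu0 : nu set0 = 0. Proof. exact: integral_set0. Qed.

Let nu_ge0 A : 0 <= nu A. Proof. by apply: integral_ge0 => x _. Qed.

Let nu_sigma_additive : semi_sigma_additive nu.
Proof.
move=> F mF tF mUF; rewrite /density ge0_integral_bigcup//.
  by apply: is_cvg_ereal_nneg_natsum => n _; exact: nu_ge0.
exact: measurable_funTS.
Qed.

HB.instance Definition _ := isMeasure.Build _ _ _ nu nu0 nu_ge0 nu_sigma_additive.

End Density.

Lemma finite_setT_mrestr d (T : measurableType d) (R : realType)
    (mu : {measure set T -> \bar R}) (U : set T) (mU : measurable U) :
  (mu U < +oo -> mrestr mu mU setT < +oo)%E.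
Proof. by rewrite /mrestr setTI. Qed.

Section LscMajorant.
Context {R : realType} {X : pmetricType R}.
Variable mu : {measure set (borel X) -> \bar R}.
Local Open Scope ereal_scope.

(* The majorant is [sup_k (k + 1) 1_(O_k)] with [O_k] open, containing
   [{f > k}] and so close to it that [(k + 1) mu (O_k \ {f > k})] is summable. *)
Lemma lsc_majorant (U : set X) (f : X -> \bar R) : open U -> mu U < +oo ->
  measurable_fun [set: borel X] f -> (forall x, 0 <= f x) ->
  \int[mu]_(x in U) f x < +oo ->
  exists h : X -> \bar R, [/\ forall a : R, open [set x | a%:E < h x],
    forall x, 0 <= h x, forall x, U x -> f x <= h x &
    \int[mu]_(x in U) h x < +oo].
Proof.
move=> oU muU mf f0 foo; have mU := borel_open oU.
pose A (k : nat) := U `&` [set x | k%:R%:E < f x].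
have mA k : measurable (A k : set (borel X)).
  have := emeasurable_fun_o_infty measurableT mf k%:R%:E.
  by rewrite setTI => mk; exact: measurableI.
(* The factor [1 / k.+1] absorbs the height of the step [g k], so the total error is at most the sum
   of [2 ^ - k.+1]. *)
pose e (k : nat) : R := (1 / (2 ^ k.+1)%:R / k.+1%:R)%R.
have e0 k : (0 < e k)%R by rewrite !divr_gt0// ltr0n expn_gt0.
have /choice[V VA] k := outer_regular (finite_setT_mrestr mU muU) (mA k) (e0 k).
have mV k : measurable (V k : set (borel X)) by apply: borel_open; case: (VA k).
pose g (k : nat) (x : X) : \bar R := (k.+1%:R * \1_(V k) x)%:E.
pose h x := ereal_sup (range (g^~ x)).
have g0 k x : 0 <= g k x by rewrite lee_fin mulr_ge0.
have h0 x : 0 <= h x.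
  by apply: (le_trans (g0 0%N x)); apply: ereal_sup_ubound; exists 0%N.
have lsch a : open [set x | a%:E < h x].
  rewrite (_ : mkset _ = \bigcup_k [set x | a%:E < g k x]).
    apply: bigcup_open => k _; rewrite /g; have [a0|a0] := ltP a 0%R.
      rewrite (_ : mkset _ = setT); first exact: openT.
      by rewrite -subTset => x _ /=; rewrite lte_fin (lt_le_trans a0)// mulr_ge0.
    have [ak|ka] := ltP a k.+1%:R.
      rewrite (_ : mkset _ = V k); first by case: (VA k).
      apply/seteqP; split => x /=; rewrite lte_fin indicE.
        by case: (boolP (x \in V k)); [rewrite inE|rewrite mulr0 ltNge a0].
      by move=> Vx; rewrite mem_set// mulr1.
    rewrite (_ : mkset _ = set0); first exact: open0.
    rewrite -subset0 => x /=; rewrite lte_fin ltNge (le_trans _ ka)//.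
    by rewrite ler_piMr// indicE; case: (_ \in _).
  apply/seteqP; split => x /=.
    by move/ereal_sup_gt => [_ [k _ <-] ?]; exists k.
  by move=> [k _ /= ag]; apply: (lt_le_trans ag); apply: ereal_sup_ubound; exists k.
exists h; split => //.
- move=> x Ux; case fx : (f x) => [r| |]; last by rewrite leNye.
  + have r0 : (0 <= r)%R by rewrite -lee_fin -fx.
    have [|rn] := leP r 0%R; first by move=> r0'; apply: le_trans (h0 x); rewrite lee_fin.
    have [k kr] : exists k : nat, (k%:R < r <= k.+1%:R)%R.
      (* The boolean subtracts one when [r] is an integer, as the lower inequality must be
         strict. *)
      exists (Num.truncn r - (r == (Num.truncn r)%:R))%N.
      have /andP[tr rt] := truncn_itv r0.
      have [rE|rE] := eqVneq r (Num.truncn r)%:R.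
        have t1 : (0 < Num.truncn r)%N by rewrite -(ltr0n R) -rE.
        by rewrite subn1 prednK// -rE lexx andbT [ltRHS]rE ltr_nat prednK.
      by rewrite subn0 (ltW rt) andbT lt_neqAle tr andbT eq_sym.
    have /andP[kr1 kr2] := kr.
    have Ak : A k x by split => //=; rewrite fx lte_fin.
    apply: (@le_trans _ _ (g k x)); last by apply: ereal_sup_ubound; exists k.
    rewrite lee_fin indicE mem_set ?mulr1//.
    by have [_ + _] := VA k; exact.
  + rewrite leye_eq; apply/eqP/eqyP => M M0.
    have [k Mk] : exists k : nat, (M <= k.+1%:R)%R.
      by exists (Num.truncn M); rewrite ltW// truncnS_gt.
    have Ak : A k x by split => //=; rewrite fx ltry.
    apply: (@le_trans _ _ (g k x)); last by apply: ereal_sup_ubound; exists k.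
    rewrite lee_fin indicE mem_set ?mulr1//.
    by have [_ + _] := VA k; exact.
pose B k := (V k `\` A k) `&` U.
have mB k : measurable (B k : set (borel X)).
  by apply: measurableI => //; exact: measurableD.
pose gB (k : nat) (x : borel X) : \bar R := (k.+1%:R * \1_(B k) x)%:E.
have mgB : forall k, measurable_fun (U : set (borel X)) (gB k).
  by move=> k; apply/measurable_EFinP; apply: measurable_funM => //;
    apply: measurable_funTS; exact: measurable_indic.
have gB0 : forall k (x : X), U x -> 0 <= gB k x.
  by move=> k x _; rewrite lee_fin mulr_ge0.
(* On [A k] the step of height [k.+1] is below [f + 1]; elsewhere on [U] it is a term of the error
   series. *)
apply: (@le_lt_trans _ _ (\int[mu]_(x in U) (f x + 1 +
    \sum_(k <oo) gB k x))).
  apply: ge0_le_integral => //.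
  - by apply: measurable_funTS; exact: lsc_borel.
  - apply: emeasurable_funD; last by apply: ge0_emeasurable_sum => // k x Ux _; exact: gB0.
    by apply: emeasurable_funD; [exact: measurable_funTS|exact: measurable_cst].
  move=> x Ux; apply: ge_ereal_sup => _ [k _ <-].
  have s0 : 0 <= \sum_(k <oo) gB k x.
    by apply: nneseries_ge0 => n _ _; exact: gB0.
  have fs0 : 0 <= f x + 1 by rewrite adde_ge0.
  have [Vx|nVx] := pselect (V k x); last first.
    by rewrite /g indicE memNset// mulr0 adde_ge0.
  have [Ax|nAx] := pselect (A k x).
    rewrite /g indicE mem_set// mulr1 (le_trans _ (leeDl _ s0))//.
    by rewrite -natr1 EFinD leeD2r// ltW//; case: Ax.
  have gkB : g k x = gB k x by rewrite /g /gB !indicE (mem_set Vx) mem_set.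
  rewrite gkB (le_trans _ (leeDr _ fs0))// (@nneseriesD1 _ _ k)// => [|n _]; last exact: gB0.
  by rewrite leeDl//; apply: nneseries_ge0 => n _ _; exact: gB0.
rewrite ge0_integralD//; last 4 first.
- by move=> x _; rewrite adde_ge0.
- by apply: emeasurable_funD; [exact: measurable_funTS|exact: measurable_cst].
- by move=> x Ux; apply: nneseries_ge0 => n _ _; exact: gB0.
- by apply: ge0_emeasurable_sum => // k x Ux _; exact: gB0.
rewrite ge0_integralD//; last exact: measurable_funTS.
rewrite integral_cst// mul1e; apply: lte_add_pinfty.
  by apply: lte_add_pinfty.
rewrite integral_nneseries//.
apply: (@le_lt_trans _ _ (\sum_(k <oo) (1 / (2 ^ k.+1)%:R)%:E)); last first.
  by apply: (le_lt_trans (epsilon_trick0 predT ler01)); rewrite ltry.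
apply: lee_nneseries => [k _ _|k _]; first by apply: integral_ge0 => x Ux; exact: gB0.
rewrite /gB; under eq_integral do rewrite EFinM.
rewrite ge0_integralZl//; last first.
  by apply/measurable_EFinP; apply: measurable_funTS; exact: measurable_indic.
rewrite integral_indic// -[X in _ <= X%:E](@divfK _ k.+1%:R)// muleC.
rewrite [leRHS]EFinM lee_wpmul2r ?lee_fin// /B -setIA setIid.
by apply: ltW; have [_ _] := VA k.
Qed.

End LscMajorant.

(** * Curves of Lipschitz constant 1 and their cost *)

(** The hypothesis says that [mu2] on [D'] is dominated by [K] times the image under [sigma] of
    [mu1] on [D], and integrals are monotone in the measure. *)
Lemma le_pushforward_integral d1 d2 (T1 : measurableType d1)
    (T2 : measurableType d2) (R : realType) (mu1 : {measure set T1 -> \bar R})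
    (mu2 : {measure set T2 -> \bar R}) (K : {nonneg R}) (sigma : T1 -> T2)
    (D : set T1) (D' : set T2) (h : T2 -> \bar R) :
  measurable_fun setT sigma -> measurable D -> measurable D' ->
  (forall S, measurable S ->
    (mu2 (S `&` D') <= K%:num%:E * mu1 (sigma @^-1` S `&` D))%E) ->
  measurable_fun setT h -> (forall x, 0 <= h x)%E ->
  (\int[mu2]_(x in D') h x <= K%:num%:E * \int[mu1]_(t in D) h (sigma t))%E.
Proof.
move=> msigma mD mD' m12 mh h0.
pose nu : {measure set T1 -> \bar R} := mrestr mu1 mD.
pose nus : {measure set T2 -> \bar R} :=
  measure_function_pushforward__canonical__measure_function_Measure nu msigma.
pose m1 : {measure set T2 -> \bar R} := mrestr mu2 mD'.
pose m2 : {measure set T2 -> \bar R} := mscale K nus.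
have -> : (\int[mu2]_(x in D') h x = \int[m1]_(x in D') h x)%E.
  by apply: eq_measure_integral => A mA AD'; rewrite /m1/= /mrestr setIidl.
apply: (@le_trans _ _ (\int[m2]_(x in D') h x)%E).
  exact: (@ge0_le_measure_integral _ _ _ m1 m2).
apply: (@le_trans _ _ (\int[m2]_(x in setT) h x)%E).
  exact: ge0_subset_integral.
rewrite ge0_integral_mscale// lee_wpmul2l ?lee_fin//.
rewrite ge0_integral_pushforward//.
rewrite preimage_setT (@ge0_negligible_integral _ _ _ nu _ (~` D))//.
- rewrite setTD setCK le_eqVlt; apply/orP; left; apply/eqP.
  apply: eq_measure_integral => A mA AD.
  by rewrite /nu/= /mrestr setIidl.
- exact: measurableC.
- exact: measurableT_comp.
- by move=> x _ /=.
- by rewrite /nu/= /mrestr setICl measure0.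
Qed.

Section LipschitzChange.
Context {R : realType}.
Local Notation leb := (@lebesgue_measure R).
Variables (K : {nonneg R}) (sigma : R -> R).
Hypothesis sigma_lip : forall s t, `|sigma s - sigma t| <= K%:num * `|s - t|.
Local Open Scope ereal_scope.

Let sigma_continuous : continuous sigma.
Proof.
move=> x; apply/cvgrPdist_lt => e e0.
have K1 : (0 < K%:num + 1)%R by rewrite ltr_wpDl.
near=> t; apply: (le_lt_trans (sigma_lip x t)).
apply: (@le_lt_trans _ _ ((K%:num + 1) * `|x - t|)%R).
  by rewrite ler_wpM2r// lerDl.
rewrite mulrC -ltr_pdivlMr//; near: t.
by apply: cvgr_dist_lt => //; rewrite divr_gt0.
Unshelve. all: by end_near. Qed.

Let msigma : measurable_fun setT sigma.
Proof. exact: continuous_measurable_fun. Qed.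

(** Cover the preimage of [S] in [D] by half-open intervals of almost minimal total length; the
    image of each lies in an interval [K] times as long, centred at the image of the midpoint. *)
Let lipschitz_measure (S D : set R) : measurable S -> measurable D ->
  S `<=` sigma @` D -> leb S <= K%:num%:E * leb (sigma @^-1` S `&` D).
Proof.
move=> mS mD SD.
pose M := sigma @^-1` S `&` D.
have mM : measurable M.
  by apply: measurableI => //; rewrite -[X in measurable X]setTI; exact: msigma.
suff cover_le e : (0 < e)%R -> leb S <= K%:num%:E * (leb M + e%:E).
  have [Moo|Mfin] := eqVneq (leb M) +oo.
    have [K0|K0] := eqVneq K%:num 0%R.
      by have := cover_le _ ltr01; rewrite -/M Moo addye// K0 !mul0e.
    by rewrite -/M Moo gt0_muley ?leey// lte_fin lt_neqAle eq_sym K0/=.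
  have Mf : leb M \is a fin_num by rewrite ge0_fin_numE ?measure_ge0// ltey.
  apply/lee_addgt0Pr => e e0.
  have K1 : (0 < K%:num + 1)%R by rewrite ltr_wpDl.
  have := cover_le (e / (K%:num + 1))%R (divr_gt0 e0 K1).
  move/le_trans; apply; rewrite muleDr ?fin_num_adde_defr//.
  rewrite leeD2l// -EFinM lee_fin mulrCA ger_pMr// ler_pdivrMr// mul1r.
  by rewrite lerDl.
move=> e0.
have [Moo|Mfin] := eqVneq (leb M) +oo.
  (* Covers say nothing here. For [K = 0] the right-hand side is 0 by convention, but then [S] has
     at most one point. *)
  rewrite Moo addye//; have [K0|K0] := eqVneq K%:num 0%R; last first.
    by rewrite gt0_muley ?leey// lte_fin lt_neqAle eq_sym K0/=.
  have [->|/set0P[y Sy]] := eqVneq S set0; first by rewrite measure0 K0 mul0e.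
  rewrite K0 mul0e (@le_trans _ _ (leb [set y]))//; last first.
    by rewrite lebesgue_measure_set1.
  apply: le_measure; rewrite ?inE// => z Sz /=.
  have [s _ <-] := SD _ Sz; have [t _ <-] := SD _ Sy.
  have := sigma_lip s t; rewrite K0 mul0r normr_le0 subr_eq0.
  by move/eqP.
have Mf : leb M \is a fin_num by rewrite ge0_fin_numE ?measure_ge0// ltey.
have /ereal_inf_lt[z [/= I covI sIz zMe]] : leb M < leb M + e%:E.
  by rewrite lteDl.
have [mI subI] := covI.
have len i : leb (I i) = wlength idfun (I i).
  rewrite /lebesgue_measure/= /lebesgue_stieltjes_measure/= /measure_extension/=.
  by rewrite measurable_mu_extE.
have /choice[J JP] : forall i, exists J : set R, [/\ measurable J,
    sigma @` I i `<=` J & leb J <= K%:num%:E * leb (I i)].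
  move=> i; have /ocitvP [->|[[a b] /= alb ->]] := mI i.
    by exists set0; split => //; rewrite ?image_set0// !measure0 mule0.
  pose c := ((a + b) / 2)%R; pose r := (K%:num * ((b - a) / 2))%R.
  exists `[(sigma c - r)%R, (sigma c + r)%R]%classic; split.
  - exact: measurable_itv.
  - move=> _ [t + <-]; rewrite /= !in_itv/= => /andP[at_ tb].
    rewrite -ler_distlC distrC (le_trans (sigma_lip t c))// ler_wpM2l//.
    by rewrite /c ler_norml; apply/andP; split; lra.
  - rewrite !lebesgue_measure_itv/= !lte_fin alb.
    have r0 : (0 <= r)%R by rewrite /r mulr_ge0// divr_ge0// subr_ge0 ltW.
    have rE : (sigma c + r - (sigma c - r) = K%:num * (b - a))%R by rewrite /r; field.
    case: ifPn => _; rewrite -!EFinB -EFinM lee_fin ?rE//.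
    by rewrite mulr_ge0// subr_ge0 ltW.
apply: (@le_trans _ _ (\sum_(i <oo) leb (J i))).
  apply: measure_sigma_subadditive => //; first by move=> i; case: (JP i).
  move=> y Sy; have [t Dt ty] := SD y Sy.
  have [i _ Ii] : (\bigcup_i I i) t by apply: subI; split => //=; rewrite ty.
  by exists i => //; have [_ + _] := JP i; apply; exists t.
apply: (@le_trans _ _ (\sum_(i <oo) (K%:num%:E * leb (I i)))).
  by apply: lee_nneseries => // i _; case: (JP i).
rewrite nneseriesZl// lee_wpmul2l ?lee_fin//.
by rewrite (eq_eseriesr (fun i _ => len i)) sIz ltW.
Qed.

(** All reparametrizations below, namely shift, reversal and the passages to and from arc length,
    use only this half of the change of variables, which follows from the Lipschitz bound. *)
Lemma lipschitz_integral_le (h : R -> \bar R) (D D' : set R) :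
  measurable D -> measurable D' -> D' `<=` sigma @` D ->
  measurable_fun setT h -> (forall x, 0 <= h x) ->
  \int[leb]_(x in D') h x <= K%:num%:E * \int[leb]_(t in D) h (sigma t).
Proof.
move=> mD mD' D'D mh h0; apply: le_pushforward_integral => // S mS.
have mSD' : measurable (S `&` D') by exact: measurableI.
have /(lipschitz_measure mSD' mD) := subset_trans (@subIsetr _ S D') D'D.
move/le_trans; apply; rewrite lee_wpmul2l ?lee_fin// le_measure ?inE//.
- by apply: measurableI => //; rewrite -[X in measurable X]setTI; exact: msigma.
- by apply: measurableI => //; rewrite -[X in measurable X]setTI; exact: msigma.
- by apply: setSI => t [].
Qed.

End LipschitzChange.

Lemma lipschitz1_integral_le (R : realType) (sigma : R -> R) (h : R -> \bar R)
    (D D' : set R) : (forall s t, `|sigma s - sigma t| <= `|s - t|) ->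
  measurable D -> measurable D' -> D' `<=` sigma @` D ->
  measurable_fun setT h -> (forall x, 0 <= h x)%E ->
  (\int[lebesgue_measure]_(x in D') h x <=
   \int[lebesgue_measure]_(t in D) h (sigma t))%E.
Proof.
move=> ls mD mD' D'D mh h0; rewrite -[leRHS]mul1e.
apply: (@lipschitz_integral_le R 1%:nng) => // s t.
by rewrite mul1r.
Qed.

Section Curves.
Context {R : realType} {X : pmetricType R}.
Implicit Types (c e : R -> X) (g h : X -> \bar R) (f : X -> R).
Local Notation leb := (@lebesgue_measure R).

(** Curves are total on the line and carry their parameter interval separately, so they can be
    concatenated, reversed and clamped freely. Speeds below 1 are allowed, so that limits of such
    curves stay in the class. *)
Definition lip1 c := forall s t, mdist (c s) (c t) <= `|s - t|.

Lemma lip1_open c (O : set X) : lip1 c -> open O -> open (c @^-1` O).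
Proof.
move=> lc; rewrite !openE => oO t /= /oO /nbhs_ballP[e /= e0 eO].
apply/nbhs_ballP; exists e => // s ts; apply: eO; rewrite ballEmdist/=.
by apply: le_lt_trans (lc _ _) _; rewrite -ball_normE in ts.
Qed.

Lemma lip1_measurable c : lip1 c -> measurable_fun setT (c : R -> borel X).
Proof.
move=> lc; apply: (@measurability _ _ _ (borel X) _ _ (@open X)) => //.
move=> _ [V oV <-]; rewrite setTI; apply: open_measurable.
exact: lip1_open.
Qed.

Lemma lip1_comp c (sigma : R -> R) : lip1 c ->
  (forall s t, `|sigma s - sigma t| <= `|s - t|) -> lip1 (c \o sigma).
Proof. by move=> lc ls s t; exact: le_trans (lc _ _) (ls _ _). Qed.

Lemma lip1_concat c e (b d : R) : lip1 c -> lip1 e -> c b = e d ->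
  lip1 (fun t => if t <= b then c t else e (t - b + d)).
Proof.
move=> lc le cbed.
have key s t : s <= b -> b < t ->
    mdist (c s) (e (t - b + d)) <= `|s - t|.
  move=> sb bt; apply: (le_trans (metric_triangle _ (c b) _)).
  rewrite (le_trans (lerD (lc s b) (lexx _)))// cbed.
  rewrite (le_trans (lerD (lexx _) (le d _)))//.
  by rewrite !ler0_norm; lra.
move=> s t; case: (leP s b) => sb; case: (leP t b) => tb //.
- exact: key.
- by rewrite metric_sym distrC; exact: key.
- by apply: (le_trans (le _ _)); have -> : s - b + d - (t - b + d) = s - t by lra.
Qed.

Local Open Scope ereal_scope.

(** The open interval leaves the endpoints out of comparisons of integrands: at an exit time the
    curve has already left the open set that controls them. *)
Definition cost g c (a b : R) := \int[leb]_(t in `]a, b[) g (c t).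

(** Upper gradients tested on 1-Lipschitz curves: slowing a curve down only increases its cost, and
    arc length is an admissible parametrization, so for Borel nonnegative [g] the notion agrees with
    [upper_gradients]. *)
Definition curve_ug f g := forall c (a b : R), lip1 c -> (a <= b)%R ->
  `|f (c b) - f (c a)|%:E <= cost g c a b.

Section CostLemmas.
Variable g : X -> \bar R.
Hypotheses (mg : measurable_fun [set: borel X] g) (g0 : forall x, 0 <= g x).

Lemma measurable_along c : lip1 c -> measurable_fun setT (g \o c).
Proof. by move=> /lip1_measurable mc; exact: (@measurableT_comp _ _ _ R (borel X)). Qed.

Lemma cost_ge0 c a b : 0 <= cost g c a b.
Proof. by apply: integral_ge0 => t _. Qed.

Lemma costxx c a : cost g c a a = 0.
Proof. by rewrite /cost set_itvoo0 integral_set0. Qed.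

Lemma costD c (a b d : R) : lip1 c -> (a <= b)%R -> (b <= d)%R ->
  cost g c a b + cost g c b d = cost g c a d.
Proof.
move=> lc; rewrite le_eqVlt => /predU1P[->|ab]; first by rewrite costxx add0e.
rewrite le_eqVlt => /predU1P[->|bd]; first by rewrite costxx adde0.
have mgc := measurable_along lc.
rewrite /cost -(@integral_itv_bndoo _ a b _ false false); last exact: measurable_funTS.
rewrite -ge0_integral_setU//.
- congr (integral _ _ _); apply/seteqP; split => t /=; rewrite !in_itv/=.
    by move=> [/andP[-> /le_lt_trans->]//|/andP[/(lt_trans ab)-> ->]].
  move=> /andP[at_ td]; case: (leP t b) => tb; [left|right].
    by rewrite at_.
  by [].
- exact: measurable_funTS.
- apply/disj_setPRL => t /=; rewrite !in_itv/= => /andP[bt _] /andP[_].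
  by rewrite leNgt bt.
Qed.

Lemma cost_subset c (a b a' b' : R) : lip1 c -> (a <= a')%R -> (b' <= b)%R ->
  cost g c a' b' <= cost g c a b.
Proof.
move=> lc aa' bb'; apply: ge0_subset_integral => //.
- by apply: measurable_funTS; exact: measurable_along.
- apply: subset_itv; rewrite bnd_simp//.
Qed.

Lemma cost_shift c (a b d : R) : lip1 c ->
  cost g (fun t => c (t + d)%R) a b <= cost g c (a + d) (b + d).
Proof.
move=> lc; rewrite /cost.
under [leRHS]eq_integral do rewrite -[X in c X](subrK d).
apply: (@lipschitz1_integral_le R (fun t => t - d)%R (fun t => g (c (t + d)%R))) => //.
- by move=> s t; rewrite opprD addrACA subrr addr0.
- move=> t /=; rewrite in_itv/= => tab; exists (t + d)%R; last by rewrite addrK.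
  by rewrite in_itv/= !ltrD2r.
- apply: (@measurable_along (fun t => c (t + d)%R)); apply: lip1_comp => // s t.
  by rewrite opprD addrACA subrr addr0.
Qed.

Lemma cost_rev c (a b : R) : lip1 c ->
  cost g (fun t => c (- t)%R) (- b) (- a) <= cost g c a b.
Proof.
move=> lc; rewrite /cost.
have lN (s t : R) : (`|- s - - t| <= `|s - t|)%R by rewrite -opprD normrN.
under [leRHS]eq_integral do rewrite -[X in c X]opprK.
apply: (@lipschitz1_integral_le R (fun t => - t)%R (fun t => g (c (- t)%R))) => //.
- move=> t /=; rewrite in_itv/= => /andP[tb ta]; exists (- t)%R; last by rewrite opprK.
  by rewrite in_itv/= ltrNr ta ltrNl.
- exact: (@measurable_along (fun t => c (- t)%R) (lip1_comp lc lN)).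
Qed.

Lemma cost_le h c (a b : R) : lip1 c -> measurable_fun [set: borel X] h ->
  (forall t, (a < t < b)%R -> g (c t) <= h (c t)) -> cost g c a b <= cost h c a b.
Proof.
move=> lc mh gh; apply: ge0_le_integral => //.
- by apply: measurable_funTS; exact: measurable_along.
- apply: measurable_funTS; apply: (@measurableT_comp _ _ _ R (borel X)) => //.
  exact: lip1_measurable.
Qed.

Lemma eq_cost c e (a b : R) : (forall t, (a < t < b)%R -> c t = e t) ->
  cost g c a b = cost g e a b.
Proof. by move=> ce; apply: eq_integral => t; rewrite inE/= in_itv/= => /ce ->. Qed.

End CostLemmas.

(** The exit time is the infimum of the times outside [B]; as [B] is open, the curve is outside [B]
    at that time. *)
Lemma first_exit c (B : set X) (a b : R) : lip1 c -> open B -> (a <= b)%R ->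
  (forall t, (a <= t <= b)%R -> B (c t)) \/
  exists s, [/\ (a <= s <= b)%R, ~ B (c s) & forall t, (a <= t < s)%R -> B (c t)].
Proof.
move=> lc oB ab.
pose S := [set t | (a <= t <= b)%R /\ ~ B (c t)].
have [S0|S0] := pselect (S !=set0); last first.
  left=> t tab; apply: contrapT => nB; apply: S0; by exists t.
right; pose s := inf S.
have lbS : lbound S a by move=> t [/andP[]].
have iS : has_inf S by split => //; exists a.
have as_ : (a <= s)%R by apply: lb_le_inf.
have sb : (s <= b)%R.
  case: S0 => t St; apply: le_trans (ge_inf (proj2 iS) St) _.
  by case: St => /andP[].
exists s; split; first by rewrite as_ sb.
- move=> Bs; have : nbhs s (c @^-1` B).
    by apply: open_nbhs_nbhs; split => //; exact: lip1_open.
  move=> /nbhs_ballP[r /= r0 rB].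
  have [t [tab nBt] tsr] := inf_adherent r0 iS.
  have st : (s <= t)%R by apply: (ge_inf (proj2 iS)).
  apply: nBt; apply: rB; rewrite -ball_normE/= ler0_norm ?subr_le0//.
  by rewrite opprB ltrBlDl.
- move=> t /andP[at_ ts]; apply: contrapT => nB.
  have : (s <= t)%R.
    by apply: (ge_inf (proj2 iS)); split => //; rewrite at_ (le_trans (ltW ts)).
  by rewrite leNgt ts.
Qed.

Lemma last_exit c (B : set X) (a b : R) : lip1 c -> open B -> (a <= b)%R ->
  (forall t, (a <= t <= b)%R -> B (c t)) \/
  exists s, [/\ (a <= s <= b)%R, ~ B (c s) & forall t, (s < t <= b)%R -> B (c t)].
Proof.
move=> lc oB ab; have lr : lip1 (fun t => c (- t)%R).
  by apply: lip1_comp => // s t; rewrite -opprD normrN.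
have ba : (- b <= - a)%R by rewrite lerN2.
have [H|[s [/andP[bs sa] nB H]]] := first_exit lr oB ba.
- by left=> t /andP[at_ tb]; rewrite -(opprK t); apply: H; rewrite !lerN2 tb.
- right; exists (- s)%R; split => //; first by rewrite lerNr sa lerNl.
  by move=> t /andP[st tb]; rewrite -(opprK t); apply: H; rewrite lerN2 tb ltrNl.
Qed.

(* Split a curve at its first and last exit from [B]: between these two times
   only the increment of [f1] matters, before and after it the curve is in [B]. *)
Lemma curve_ug_glue f f1 g1 h g (B : set X) :
  measurable_fun [set: borel X] g1 -> (forall x, 0 <= g1 x) ->
  measurable_fun [set: borel X] h -> (forall x, 0 <= h x) ->
  measurable_fun [set: borel X] g -> (forall x, 0 <= g x) ->
  open B -> (forall x, ~ B x -> f x = f1 x) ->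
  curve_ug f1 g1 -> curve_ug f h ->
  (forall x, g1 x <= g x) -> (forall x, B x -> h x <= g x) -> curve_ug f g.
Proof.
move=> mg1 g10 mh h0 mg g0 oB ff1 ug1 ugh g1g hg c a b lc ab.
have [inB|[s [/andP[as_ sb] nBs Bs]]] := first_exit lc oB ab.
  apply: le_trans (ugh _ _ _ lc ab) _; apply: cost_le => // t /andP[at_ tb].
  by apply: hg; apply: inB; rewrite !ltW.
have [inB|[u [/andP[au ub] nBu Bu]]] := last_exit lc oB ab.
  by exfalso; apply: nBs; apply: inB; rewrite as_ sb.
have su : (s <= u)%R.
  by rewrite leNgt; apply/negP => us; apply: nBs; apply: Bu; rewrite us sb.
rewrite -(costD mg g0 lc as_ sb) -(costD mg g0 lc su ub).
have -> : (f (c b) - f (c a) =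
    (f (c s) - f (c a)) + ((f1 (c u) - f1 (c s)) + (f (c b) - f (c u))))%R.
  by rewrite -!ff1//; lra.
apply: (@le_trans _ _ (`|f (c s) - f (c a)|%:E + (`|f1 (c u) - f1 (c s)|%:E
    + `|f (c b) - f (c u)|%:E))).
  by rewrite -!EFinD lee_fin (le_trans (ler_normD _ _))// lerD2l ler_normD.
apply: leeD; last apply: leeD.
- apply: le_trans (ugh _ _ _ lc as_) _; apply: cost_le => // t /andP[at_ ts].
  by apply: hg; apply: Bs; rewrite ts ltW.
- by apply: le_trans (ug1 _ _ _ lc su) _; apply: cost_le.
- apply: le_trans (ugh _ _ _ lc ub) _; apply: cost_le => // t /andP[ut tb].
  by apply: hg; apply: Bu; rewrite ut ltW.
Qed.

End Curves.

(** * Length of curves and constant-speed parametrization *)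

Section CurveLength.
Context {R : realType} {X : pmetricType R}.
Implicit Types (c : R -> X) (a b t : R) (s : seq R).
Local Open Scope ereal_scope.

Lemma curve_variation_nil a b c : curve_variation a b c [::] = 0%R.
Proof. by rewrite /curve_variation big_ord0. Qed.

Lemma curve_variation_cons a b c x s :
  curve_variation a b c (x :: s) =
  (mdist (c a) (c x) + curve_variation x b c s)%R.
Proof.
by rewrite /curve_variation/= big_ord_recl/=; congr (_ + _)%R.
Qed.

Lemma curve_length_ge_variation a b c s : itv_partition a b s ->
  (curve_variation a b c s)%:E <= curve_length a b c.
Proof. by move=> ps; apply: ereal_sup_ubound; exists s. Qed.

Lemma curve_length_le a b c (M : \bar R) :
  (forall s, itv_partition a b s -> (curve_variation a b c s)%:E <= M) ->
  curve_length a b c <= M.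
Proof. by move=> sM; apply: ge_ereal_sup => _ [s /sM ? <-]. Qed.

Lemma curve_lengthxx a c : curve_length a a c = 0.
Proof.
apply/eqP; rewrite eq_le; apply/andP; split.
  by apply: curve_length_le => s /itv_partitionxx ->; rewrite curve_variation_nil.
have /(curve_length_ge_variation c) : itv_partition a a [::] by split.
by rewrite curve_variation_nil.
Qed.

Lemma curve_length_ge_dist a b c : (a <= b)%R ->
  (mdist (c a) (c b))%:E <= curve_length a b c.
Proof.
rewrite le_eqVlt => /predU1P[->|ab]; first by rewrite mdistxx curve_lengthxx.
have := curve_length_ge_variation c (itv_partition1 ab).
by rewrite curve_variation_cons curve_variation_nil addr0.
Qed.

Lemma curve_length_ge0 a b c : (a <= b)%R -> 0 <= curve_length a b c.
Proof.
by move=> ab; apply: le_trans (curve_length_ge_dist c ab); rewrite lee_fin mdist_ge0.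
Qed.

Lemma curve_length_cons a x b c : (a < x)%R ->
  (mdist (c a) (c x))%:E + curve_length x b c <= curve_length a b c.
Proof.
move=> ax; rewrite addeC -leeBrDr//; apply: curve_length_le => s [pxs xsb].
rewrite leeBrDr// addeC -EFinD -(curve_variation_cons a b).
by apply: curve_length_ge_variation; split => //=; rewrite ax.
Qed.

Lemma curve_length_split a m b c : (a <= m)%R -> (m <= b)%R ->
  curve_length a b c <= curve_length a m c + curve_length m b c.
Proof.
move=> am mb; apply: curve_length_le => s.
elim: s a am => [|x s ih] a am.
  move=> _; rewrite curve_variation_nil.
  by apply: adde_ge0; exact: curve_length_ge0.
move=> /[dup] pas [/= /andP[ax pxs] xsb]; rewrite curve_variation_cons EFinD.
have pxb : itv_partition x b s by split.
have [xm|mx] := leP x m.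
  apply: le_trans (leeD2r _ (curve_length_cons m c ax)).
  by rewrite -addeA leeD2l// ih.
apply: (@le_trans _ _ ((mdist (c a) (c m))%:E +
   ((mdist (c m) (c x))%:E + (curve_variation x b c s)%:E))).
  by rewrite addeA leeD2r// -EFinD lee_fin metric_triangle.
apply: leeD; first exact: curve_length_ge_dist.
rewrite -EFinD -(curve_variation_cons m b).
by apply: curve_length_ge_variation; split => //=; rewrite mx.
Qed.

Lemma curve_length_variation_add a m b c s : (m <= b)%R -> itv_partition a m s ->
  (curve_variation a m c s)%:E + curve_length m b c <= curve_length a b c.
Proof.
move=> mb; elim: s a => [|x s ih] a.
  by move=> /itv_partition_nil ->; rewrite curve_variation_nil add0e.
move=> [/= /andP[ax pxs] xsm]; rewrite curve_variation_cons EFinD -addeA.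
by apply: le_trans (curve_length_cons b c ax); rewrite leeD2l// ih.
Qed.

Lemma curve_length_concat a m b c : (a <= m)%R -> (m <= b)%R ->
  curve_length a b c = curve_length a m c + curve_length m b c.
Proof.
move=> am mb; apply/eqP; rewrite eq_le curve_length_split//=.
have [mboo|mboo] := eqVneq (curve_length m b c) +oo.
  move: am; rewrite (le_eqVlt a) => /predU1P[->|am]; first by rewrite curve_lengthxx add0e.
  have := curve_length_variation_add c mb (itv_partition1 am).
  by rewrite mboo addey// leye_eq => /eqP ->; rewrite leey.
have mbfin : curve_length m b c \is a fin_num.
  by rewrite ge0_fin_numE ?curve_length_ge0// ltey.
rewrite -leeBrDr//; apply: curve_length_le => s ps; rewrite leeBrDr//.
exact: curve_length_variation_add.
Qed.

Lemma curve_length_lipschitz (K : R) c a b : (a <= b)%R ->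
  (forall u v, mdist (c u) (c v) <= K * `|u - v|)%R ->
  curve_length a b c <= (K * (b - a))%:E.
Proof.
move=> ab cK; apply: curve_length_le => s ps.
elim: s a ab ps => [|x s ih] a ab.
  by move=> /itv_partition_nil ->; rewrite curve_variation_nil subrr mulr0.
move=> /[dup] /itv_partition_cons pxs [/= /andP[ax _] _].
rewrite curve_variation_cons EFinD (_ : (K * (b - a))%:E = (K * (x - a) + K * (b - x))%:E).
  rewrite EFinD leeD// ?ih// ?(itv_partition_le pxs)// lee_fin (le_trans (cK _ _))//.
  by rewrite distrC gtr0_norm// subr_gt0.
by congr (_%:E); ring.
Qed.

(* Approximate the length by a partition and move its last point to the left. *)
Lemma curve_length_left a b c s : (a < b)%R -> itv_partition a b s ->
  (exists2 p, (a <= p < b)%R & forall t, (p < t < b)%R ->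
    (curve_variation a b c s)%:E <= curve_length a t c + (mdist (c t) (c b))%:E).
Proof.
elim: s a => [|x s ih] a ab.
  by move=> /itv_partition_nil abE; rewrite abE ltxx in ab.
move=> /[dup] /itv_partition_cons pxs [/= /andP[ax _] _].
have := itv_partition_le pxs; rewrite (le_eqVlt x) => /predU1P[xb|xb].
  move: pxs; rewrite xb => /itv_partitionxx ->.
  exists a; first by rewrite lexx.
  move=> t /andP[at_ tb]; rewrite curve_variation_cons curve_variation_nil addr0.
  apply: (@le_trans _ _ ((mdist (c a) (c t))%:E + (mdist (c t) (c b))%:E)).
    by rewrite -EFinD lee_fin metric_triangle.
  by rewrite leeD2r// curve_length_ge_dist// ltW.
have [p /andP[xp pb] pt] := ih x xb pxs.
exists p; first by rewrite pb (le_trans (ltW ax)).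
move=> t /[dup] /andP[ptt tb] /pt; rewrite curve_variation_cons EFinD => H.
apply: (le_trans (leeD2l _ H)); rewrite addeA leeD2r//.
exact: curve_length_cons.
Qed.

Section Rectifiable.
Variable c : R -> X.
Hypothesis rc : rectifiable c.

Let len t := curve_length 0 t c.

Let len_fin t : (0 <= t <= 1)%R -> len t \is a fin_num.
Proof.
move=> /andP[t0 t1]; rewrite ge0_fin_numE ?curve_length_ge0//.
apply: le_lt_trans (rc.2); rewrite (curve_length_concat c t0 t1).
by rewrite leeDl// curve_length_ge0.
Qed.

Let c_near t (e : R) : (0 <= t <= 1)%R -> (0 < e)%R ->
  exists2 d, (0 < d)%R & forall u, (0 <= u <= 1)%R -> (`|t - u| < d)%R ->
    (mdist (c t) (c u) < e)%R.
Proof.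
move=> t01 e0; have /subspace_continuousP cc := rc.1.
have t01' : `[0%R, 1%R]%classic t by rewrite /= in_itv.
have /(cc t t01') : nbhs (c t) (ball (c t) e) by exact: nbhsx_ballx.
move=> /nbhs_ballP[d /= d0 dH]; exists d => // s s01 ts.
by have := dH s; rewrite -ball_normE/= in_itv/= ballEmdist/=; exact.
Qed.

(** An intermediate value argument at [t0], the supremum of the times of length at most [v]:
    approximation from the left bounds the length at [t0] above by [v], continuity from the right
    bounds it below. *)
Lemma rectifiable_length_surj (u : R) : (0 <= u <= 1)%R ->
  exists2 t, (0 <= t <= 1)%R & curve_length 0 t c = u%:E * curve_length 0 1 c.
Proof.
move=> /andP[u0 u1]; set v := u%:E * _.
have L0 : 0 <= len 1 by exact: curve_length_ge0.
have v0 : 0 <= v by rewrite mule_ge0.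
have vL : v <= len 1 by rewrite /v -[leRHS]mul1e lee_wpmul2r.
pose S := [set t | (0 <= t <= 1)%R /\ len t <= v].
have S00 : S 0%R by split; [rewrite lexx ler01|rewrite /len curve_lengthxx].
have supS : has_sup S by split; [exists 0%R|exists 1%R => t [/andP[]]].
pose t0 := sup S.
have t00 : (0 <= t0)%R by exact: (ub_le_sup supS.2).
have t01 : (t0 <= 1)%R by apply: ge_sup => [|t [/andP[]]//]; exists 0%R.
have t001 : (0 <= t0 <= 1)%R by rewrite t00.
exists t0 => //; apply/eqP; rewrite eq_le; apply/andP; split.
- move: t00; rewrite (le_eqVlt 0%R) => /predU1P[<-|t0_gt0]; first by rewrite curve_lengthxx.
  apply: curve_length_le => s ps.
  (* For [t] past [p], the variation along [s] is at most the length up to [t], hence [v], plus a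
     short last jump. *)
  have [p /andP[p0 pt0] pH] := curve_length_left c t0_gt0 ps.
  apply/lee_addgt0Pr => e e0; have [d d0 dH] := c_near t001 e0.
  have m0 : (0 < Num.min d (t0 - p))%R by rewrite lt_min d0 subr_gt0.
  have [t [/andP[t0' t1'] tv] ttm] := sup_adherent m0 supS.
  move: ttm; rewrite ltrBlDr -ltrBlDl lt_min => /andP[td tp].
  have tt0 : (t <= t0)%R by apply: (ub_le_sup supS.2); split => //; rewrite t0'.
  move: tt0; rewrite (le_eqVlt t) => /predU1P[tt0|tt0].
    apply: (le_trans (curve_length_ge_variation c ps)); rewrite -[X in X <= _]adde0 -tt0.
    by apply: leeD => //; rewrite lee_fin ltW.
  apply: (le_trans (pH t _)); first by move: tp; rewrite -/t0 ltrD2l ltrN2 tt0 => ->.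
  apply: leeD => //; rewrite lee_fin metric_sym ltW// dH ?t0'//.
  by rewrite ger0_norm// subr_ge0 ltW.
- move: t01; rewrite (le_eqVlt t0) => /predU1P[->//|t0_lt1].
  apply/lee_addgt0Pr => e e0; have e2 : (0 < e / 2)%R by rewrite divr_gt0.
  have [d d0 dH] := c_near t001 e2.
  have tfin : curve_length t0 1 c \is a fin_num.
    have := len_fin (_ : 0 <= 1 <= 1)%R; rewrite ler01 lexx => /(_ isT).
    rewrite /len (curve_length_concat c t00 (ltW t0_lt1)) fin_numD.
    by move=> /andP[].
  have [_ [s ps <-] sH] := ub_ereal_sup_adherent e2 tfin.
  case: s ps sH => [/itv_partition_nil t0E|x s ps sH].
    by rewrite t0E ltxx in t0_lt1.
  have [/= /andP[t0x pxs] xs1] := ps.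
  (* The point [t0 + r] precedes the first point [x] of an almost optimal partition of [[t0, 1]].
     Inserting it leaves a partition of [[t0 + r, 1]] and one short jump, each approximation costing
     [e / 2]. *)
  pose r := (Num.min d (Num.min (x - t0) (1 - t0)) / 2)%R.
  have m0 : (0 < Num.min d (Num.min (x - t0) (1 - t0)))%R.
    by rewrite !lt_min d0 !subr_gt0 t0x.
  have r0 : (0 < r)%R by rewrite divr_gt0.
  have : (r < Num.min d (Num.min (x - t0) (1 - t0)))%R.
    by rewrite /r ltr_pdivrMr// mulr_natr mulr2n ltrDl.
  rewrite !lt_min => /and3P[rd rx r1].
  pose t := (t0 + r)%R.
  have t0t : (t0 < t)%R by rewrite ltrDl.
  have tx : (t < x)%R by rewrite /t -ltrBrDl.
  have t1 : (t <= 1)%R by rewrite /t ltW// -ltrBrDl.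
  have t_ge0 : (0 <= t)%R by rewrite ltW// (le_lt_trans t00).
  have vt : v <= len t.
    rewrite leNgt; apply/negP => tv; have : (t <= t0)%R.
      by apply: (ub_le_sup supS.2); split; [rewrite t_ge0|exact: ltW].
    by rewrite leNgt t0t.
  apply: (le_trans vt).
  have t1fin : curve_length t 1 c \is a fin_num.
    have := len_fin (_ : 0 <= 1 <= 1)%R; rewrite ler01 lexx => /(_ isT).
    rewrite /len (curve_length_concat c t_ge0 t1) fin_numD.
    by move=> /andP[].
  rewrite -(leeD2rE _ _ t1fin) -(curve_length_concat c t_ge0 t1).
  rewrite (curve_length_concat c t00 (ltW t0_lt1)) -addeA leeD2l//.
  rewrite -/(curve_length t0 1 c) lteBlDr// in sH; apply: (le_trans (ltW sH)).
  have -> : e%:E = (e / 2)%:E + (e / 2)%:E by rewrite -EFinD -splitr.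
  rewrite [leRHS]addeC addeA leeD2r//.
  rewrite curve_variation_cons EFinD.
  apply: (@le_trans _ _ ((mdist (c t0) (c t))%:E +
     ((mdist (c t) (c x))%:E + (curve_variation x 1 c s)%:E))).
    by rewrite addeA leeD2r// -EFinD lee_fin metric_triangle.
  rewrite addeC; apply: leeD.
    rewrite -EFinD -(curve_variation_cons t 1).
    by apply: curve_length_ge_variation; split => //=; rewrite tx.
  rewrite lee_fin ltW// dH ?t_ge0//.
  by rewrite distrC ger0_norm ?subr_ge0 1?ltW// /t addrAC subrr add0r.
Qed.

End Rectifiable.

End CurveLength.

(** * Upper gradients tested on rectifiable and on 1-Lipschitz curves *)

Section UpperGradientCurves.
Context {R : realType} {X : pmetricType R}.
Implicit Types (c : R -> X) (f : X -> R) (g : X -> \bar R).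
Local Open Scope ereal_scope.

(** Precomposition with it extends a curve from [[a, b]] to the line by constants, without
    increasing the Lipschitz constant. *)
Definition clamp (a b t : R) : R := Num.max a (Num.min b t).

Lemma clamp_itv a b t : (a <= b)%R -> (a <= clamp a b t <= b)%R.
Proof. by move=> ab; rewrite /clamp le_max lexx ge_max ab ge_min lexx. Qed.

Lemma clamp_id a b t : (a <= t <= b)%R -> clamp a b t = t.
Proof. by move=> /andP[at_ tb]; rewrite /clamp (min_idPr tb) (max_idPr at_). Qed.

Lemma clamp_clamp a b d t : (a <= b)%R -> (b <= d)%R ->
  clamp a b (clamp a d t) = clamp a b t.
Proof.
move=> ab bd; have [ta|at_] := leP t a.
  have lo e : (a <= e)%R -> clamp a e t = a.
    by move=> ae; rewrite /clamp min_r ?max_l// (le_trans ta).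
  by rewrite (lo d) ?(le_trans ab)// lo// clamp_id// lexx.
have [td|dt] := leP t d; first by rewrite (@clamp_id a d)// ltW.
have hi e : (a <= e)%R -> (e <= t)%R -> clamp a e t = e.
  by move=> ae et; rewrite /clamp min_l// max_r.
rewrite (hi d) ?(hi b) ?(le_trans ab bd)//; last 2 first.
- exact: le_trans bd (ltW dt).
- exact: ltW.
by rewrite /clamp min_l// max_r.
Qed.

Lemma clamp_lip a b s t : (`|clamp a b s - clamp a b t| <= `|s - t|)%R.
Proof.
wlog st : s t / (s <= t)%R.
  by move=> H; case: (leP s t) => [/H//|/ltW/H]; rewrite distrC [in leRHS]distrC.
rewrite [leRHS]ler0_norm ?subr_le0// ler_norml /clamp.
by case: (leP b s) => bs; case: (leP b t) => bt; case: (leP a b) => ab;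
  case: (leP a s) => as_; case: (leP a t) => at_; apply/andP; split; lra.
Qed.

Section ConstSpeed.
Variable c : R -> X.
Hypothesis rc : rectifiable c.
Let L := fine (curve_length 0 1 c).

Lemma rectifiable_fineK : L%:E = curve_length 0 1 c.
Proof. by rewrite fineK// ge0_fin_numE ?rc.2// curve_length_ge0. Qed.

Lemma rectifiable_length_ge0 : (0 <= L)%R.
Proof. by rewrite -lee_fin rectifiable_fineK curve_length_ge0. Qed.

Lemma const_speed_lip u v : (0 <= u <= 1)%R -> (0 <= v <= 1)%R ->
  (mdist (const_speed c u) (const_speed c v) <= L * `|u - v|)%R.
Proof.
wlog uv : u v / (u < v)%R.
  move=> H; case: (ltgtP u v) => [/H//|/H vu u01 v01|-> _ _].
    by rewrite metric_sym distrC; exact: vu.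
  by rewrite mdistxx subrr normr0 mulr0.
move=> u01 v01.
have [s s01 su] := rectifiable_length_surj rc u01.
have [t t01 tv] := rectifiable_length_surj rc v01.
rewrite (const_speedE rc _ su) ?in_itv// (const_speedE rc _ tv) ?in_itv//.
case: (leP s t) => st.
  move: st; rewrite (le_eqVlt s) => /predU1P[->|st].
    by rewrite mdistxx mulr_ge0// rectifiable_length_ge0.
  have /andP[s0 _] := s01; have := curve_length_ge c s0 st.
  rewrite su tv -rectifiable_fineK -!EFinM -EFinD lee_fin.
  by rewrite ltr0_norm ?subr_lt0//; lra.
(* Here [t < s] although [u < v]: the distance is then at most [L * (u - v)], hence zero. *)
have /andP[t0 _] := t01; have := curve_length_ge c t0 st.
rewrite su tv -rectifiable_fineK -!EFinM -EFinD lee_fin metric_sym.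
rewrite ltr0_norm ?subr_lt0// => H.
suff : (0 <= L * (v - u))%R by lra.
by rewrite mulr_ge0 ?rectifiable_length_ge0// subr_ge0 ltW.
Qed.

Lemma const_speed0 : const_speed c 0 = c 0%R.
Proof.
by apply: const_speedE; rewrite ?in_itv/= ?lexx ?ler01// curve_lengthxx mul0e.
Qed.

Lemma const_speed1 : const_speed c 1 = c 1%R.
Proof. by apply: const_speedE; rewrite ?in_itv/= ?lexx ?ler01// mul1e. Qed.

(** The arc-length parametrization, extended by constants beyond [[0, L]]. *)
Lemma const_speed_lip1 : (0 < L)%R ->
  lip1 (fun s => const_speed c (clamp 0 1 (s / L))).
Proof.
move=> L0 s t; apply: (le_trans (const_speed_lip _ _)); rewrite ?clamp_itv//.
apply: (@le_trans _ _ (L * `|s / L - t / L|)%R); first by rewrite ler_pM2l// clamp_lip.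
by rewrite -mulrBl normrM [(`|L^-1|)%R]gtr0_norm ?invr_gt0// mulrCA divff ?mulr1// gt_eqF.
Qed.

Lemma measurable_along_const_speed g : measurable_fun [set: borel X] g ->
  (0 < L)%R -> measurable_fun setT (fun u : R => g (const_speed c (clamp 0 1 u))).
Proof.
move=> mg L0; rewrite (_ : (fun u => _) =
  (g \o fun s => const_speed c (clamp 0 1 (s / L))) \o (fun u => u * L)%R).
  apply: measurableT_comp; first exact: (measurable_along mg (const_speed_lip1 L0)).
  exact: measurable_funM.
by apply/funext => u /=; rewrite mulfK// gt_eqF.
Qed.

(** The clamp replaces the default value of [const_speed] outside [[0, 1]], so that measurability is
    available on the whole line. *)
Lemma path_integral_open g : measurable_fun [set: borel X] g -> (0 < L)%R ->
  path_integral g c =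
  L%:E * \int[lebesgue_measure]_(u in `]0%R, 1%R[) g (const_speed c (clamp 0 1 u)).
Proof.
move=> mg L0; rewrite /path_integral -rectifiable_fineK; congr (_ * _).
transitivity (\int[lebesgue_measure]_(u in `[0%R, 1%R]) g (const_speed c (clamp 0 1 u))).
  by apply: eq_integral => u; rewrite inE/= in_itv/= => u01; rewrite clamp_id.
rewrite (@integral_itv_bndoo _ _ _ _ true false)//.
by apply: measurable_funTS; exact: measurable_along_const_speed.
Qed.

End ConstSpeed.

(** The function is tested on the arc-length parametrization, which has the same endpoints;
    rescaling by [L] turns its cost into the path integral. Curves of length zero have equal
    endpoints. *)
Lemma curve_ug_upper_gradients f g : measurable_fun [set: borel X] g ->
  (forall x, 0 <= g x) -> curve_ug f g -> upper_gradients (fun x => (f x)%:E) g.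
Proof.
move=> mg g0 ug; split=> // c rc.
have := rectifiable_length_ge0 rc; rewrite le_eqVlt => /predU1P[L0|L0].
  have := curve_length_ge_dist c ler01.
  rewrite -rectifiable_fineK// -L0 lee_fin => c01.
  rewrite (@mdist_positivity _ _ (c 0%R) (c 1%R)); last first.
    by apply/eqP; rewrite eq_le c01 mdist_ge0.
  rewrite subee// abse0 /path_integral mule_ge0//.
    by rewrite -rectifiable_fineK// -L0.
  exact: integral_ge0.
rewrite path_integral_open// -EFinB abse_EFin.
set L := fine _ in L0 *.
have lc := const_speed_lip1 rc L0.
have := ug _ _ _ lc (ltW L0).
rewrite divff ?gt_eqF// mul0r !clamp_id ?lexx ?ler01// const_speed1// const_speed0//.
move/le_trans; apply; rewrite /cost.
have le_scale := @lipschitz_integral_le R (NngNum (ltW L0)) (fun u => L * u)%R _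
  (fun s => g (const_speed c (clamp 0 1 (s / L)))) `]0%R, 1%R[%classic `]0%R, L[%classic.
apply: (le_trans (le_scale _ _ _ _ _ _)) => //=.
- by move=> s t; rewrite -mulrBr normrM gtr0_norm.
- move=> s /=; rewrite in_itv/= => /andP[s0 sL]; exists (s / L)%R.
    by rewrite in_itv/= divr_gt0//= ltr_pdivrMr// mul1r.
  by rewrite mulrC divfK// gt_eqF.
- exact: (measurable_along mg lc).
by under eq_integral do rewrite mulrAC divff ?gt_eqF// mul1r.
Qed.

(** A 1-Lipschitz curve covers at most unit length per unit time, so its path integral is at most
    its cost: the normalized length [sigma] is [1 / L]-Lipschitz, and this factor cancels the [L] in
    the path integral. *)
Lemma upper_gradients_curve_ug f g :
  upper_gradients (fun x => (f x)%:E) g -> curve_ug f g.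
Proof.
move=> [mg g0 ug] c a b lc; rewrite le_eqVlt => /predU1P[->|ab].
  by rewrite subrr normr0 cost_ge0.
have ba : (0 < b - a)%R by rewrite subr_gt0.
pose e t := c (a + (b - a) * t)%R.
have eK s t : (mdist (e s) (e t) <= (b - a) * `|s - t|)%R.
  apply: (le_trans (lc _ _)).
  by rewrite opprD addrACA subrr add0r -mulrBr normrM gtr0_norm.
have re : rectifiable e.
  split; last first.
    apply: le_lt_trans (curve_length_lipschitz ler01 eK) _.
    by rewrite ltry.
  apply: continuous_subspaceT => t W /= /nbhs_ballP[r /= r0 rW].
  apply/nbhs_ballP; exists (r / (b - a))%R; first by rewrite /= divr_gt0.
  move=> s; rewrite -ball_normE/= => ts; apply: rW; rewrite ballEmdist/=.
  by apply: (le_lt_trans (eK _ _)); rewrite mulrC -ltr_pdivlMr.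
have := ug e re.
rewrite /e mulr1 mulr0 addr0 (addrC a) subrK -EFinB abse_EFin -/e.
move/le_trans; apply.
have := rectifiable_length_ge0 re; rewrite le_eqVlt => /predU1P[L0|L0].
  by rewrite /path_integral -rectifiable_fineK// -L0 mul0e cost_ge0.
rewrite path_integral_open//; set L := fine _ in L0 *.
have lenfin t : (0 <= t <= 1)%R -> curve_length 0 t e \is a fin_num.
  move=> /andP[t0 t1]; rewrite ge0_fin_numE ?curve_length_ge0//.
  apply: (le_lt_trans (curve_length_lipschitz t0 eK)).
  by rewrite ltry.
pose len t := fine (curve_length 0 (clamp 0 1 t) e).
pose sigma s := (len ((s - a) / (b - a)) / L)%R.
have len_lip s t : (`|len s - len t| <= (b - a) * `|s - t|)%R.
  wlog st : s t / (clamp 0 1 s <= clamp 0 1 t)%R.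
    move=> H; case: (leP (clamp 0 1 s) (clamp 0 1 t)) => [/H//|/ltW/H].
    by rewrite distrC [in leRHS]distrC.
  have /andP[s0 s1] := clamp_itv s (@ler01 R).
  rewrite /len (curve_length_concat e s0 st) fineD; first last.
  - have := lenfin _ (clamp_itv t (@ler01 R)).
    by rewrite (curve_length_concat e s0 st) fin_numD => /andP[].
  - by apply: lenfin; exact: clamp_itv.
  rewrite opprD addrA subrr add0r normrN ger0_norm ?fine_ge0 ?curve_length_ge0//.
  rewrite -lee_fin fineK; last first.
    have := lenfin _ (clamp_itv t (@ler01 R)).
    by rewrite (curve_length_concat e s0 st) fin_numD => /andP[].
  apply: (le_trans (curve_length_lipschitz st eK)); rewrite lee_fin ler_pM2l//.
  rewrite distrC; apply: le_trans (clamp_lip 0 1 t s).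
  exact: ler_norm.
have L0' : (0 <= L^-1)%R by rewrite invr_ge0 ltW.
apply: (@le_trans _ _ (L%:E * ((L^-1)%:E * cost g c a b))); last first.
  by rewrite muleA -EFinM divff ?mul1e// gt_eqF.
rewrite lee_wpmul2l ?lee_fin ?(ltW L0)//.
have le_sigma := @lipschitz_integral_le R (NngNum L0') sigma _
  (fun u => g (const_speed e (clamp 0 1 u))) `]a, b[%classic `]0%R, 1%R[%classic.
apply: (le_trans (le_sigma _ _ _ _ _ _)) => //=.
- move=> s t; rewrite /sigma -mulrBl normrM [(`|L^-1|)%R]ger0_norm// mulrC ler_wpM2l//.
  apply: (le_trans (len_lip _ _)); rewrite -mulrBl opprD addrACA subrr addr0.
  by rewrite normrM [(`|(b - a)^-1|)%R]gtr0_norm ?invr_gt0// mulrCA divff ?mulr1// gt_eqF.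
- move=> u /=; rewrite in_itv/= => /andP[u0 u1].
  have u01 : (0 <= u <= 1)%R by rewrite !ltW.
  have [t t01 tu] := rectifiable_length_surj re u01.
  have tL : len t = (u * L)%R.
    by rewrite /len clamp_id// tu -(rectifiable_fineK re).
  exists (a + (b - a) * t)%R; last first.
    by rewrite /sigma addrAC subrr add0r mulrAC divff ?mul1r ?tL ?mulfK// gt_eqF.
  have [t0 t1] : (0 < t)%R /\ (t < 1)%R.
    move: t01 => /andP[t0 t1]; split.
      rewrite lt_neqAle t0 andbT; apply/eqP => t0E; move: tL.
      rewrite /len -t0E clamp_id ?lexx ?ler01// curve_lengthxx => /esym/eqP.
      by rewrite mulf_eq0 (gt_eqF u0) (gt_eqF L0).
    rewrite lt_neqAle t1 andbT; apply/eqP => t1E; move: tL.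
    rewrite /len t1E clamp_id ?lexx ?ler01// -/L -[LHS]mul1r => /(mulIf (lt0r_neq0 L0)) u1E.
    by rewrite -u1E ltxx in u1.
  rewrite in_itv/= ltrDl mulr_gt0//= -ltrBrDl -[ltRHS]mulr1 ltr_pM2l//.
- exact: measurable_along_const_speed.
rewrite lee_wpmul2l ?lee_fin// /cost le_eqVlt; apply/orP; left; apply/eqP.
apply: eq_integral => s; rewrite inE/= in_itv/= => /andP[as_ sb].
have s01 : (0 <= (s - a) / (b - a) <= 1)%R.
  apply/andP; split; first by apply: divr_ge0; rewrite subr_ge0 ltW.
  by rewrite ler_pdivrMr// mul1r lerD2r ltW.
have sig01 : (0 <= sigma s <= 1)%R.
  rewrite /sigma divr_ge0 ?fine_ge0 ?curve_length_ge0 ?(ltW L0)//=; last first.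
    by case/andP: (clamp_itv ((s - a) / (b - a)) (@ler01 R)).
  rewrite ler_pdivrMr// mul1r -lee_fin /len /L !fineK ?lenfin ?clamp_itv ?lexx ?ler01//.
  have /andP[t0 t1] := clamp_itv ((s - a) / (b - a)) (@ler01 R).
  by rewrite (curve_length_concat e t0 t1) leeDl// curve_length_ge0.
(* The constant-speed parametrization at [sigma s] is [c s], because the length of [e] up to the
   time corresponding to [s] is [sigma s * L]. *)
rewrite (clamp_id sig01) (@const_speedE _ _ e ((s - a) / (b - a))%R)//.
  rewrite /e mulrC divfK ?gt_eqF//; congr (g (c _)); lra.
rewrite -(rectifiable_fineK re) -/L -EFinM /sigma divfK ?gt_eqF// /len clamp_id//.
by rewrite fineK// lenfin.
Qed.

End UpperGradientCurves.

(** * Lower semicontinuity of the potential *)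

Section LimInf.
Context {R : realType}.
Local Open Scope ereal_scope.
Implicit Type u : (\bar R)^nat.

Lemma lee_dense (x y : \bar R) : (forall a : R, a%:E < x -> a%:E <= y) -> x <= y.
Proof.
case: x y => [r| |] [s| |] H; rewrite ?leey ?leNye//.
- rewrite leNgt; apply/negP; rewrite lte_fin => sr.
  have := H ((r + s) / 2)%R; rewrite lte_fin lee_fin.
  by have : ((r + s) / 2 < r)%R by [lra]; move=> h /(_ h); lra.
- by have := H (r - 1)%R; rewrite lte_fin ltrBlDr ltrDl ltr01 => /(_ isT); rewrite leeNy_eq.
- by have := H (s + 1)%R (ltry _); rewrite lee_fin gerDl ler10.
- by have := H 0%R (ltry _); rewrite leeNy_eq.
Qed.

Lemma limn_einf_supE u : limn_einf u = ereal_sup (range (einfs u)).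
Proof. by rewrite limn_einf_lim; apply/cvg_lim => //; exact: cvg_einfs_sup. Qed.

Lemma limn_einf_ge u a : (\forall n \near \oo, a <= u n) -> a <= limn_einf u.
Proof.
move=> [N _ aN]; rewrite limn_einf_supE.
apply: (@le_trans _ _ (einfs u N)); last by apply: ereal_sup_ubound; exists N.
by apply: le_ereal_inf_tmp => _ [n /= Nn <-]; exact: aN.
Qed.

Lemma limn_einf_le u a : (\forall n \near \oo, u n <= a) -> limn_einf u <= a.
Proof.
move=> [N _ aN]; rewrite limn_einf_supE; apply: ge_ereal_sup => _ [n _ <-].
apply: (@le_trans _ _ (u (maxn n N))); last by apply: aN => /=; rewrite leq_maxr.
by apply: ereal_inf_lbound; exists (maxn n N) => //=; rewrite leq_maxl.
Qed.

End LimInf.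

Section CostLsc.
Context {R : realType} {X : pmetricType R}.
Implicit Types (c : R -> X).
Variable G : X -> \bar R.
Local Open Scope ereal_scope.
Hypotheses (G_lsc : forall a : R, open [set x | a%:E < G x]).
Hypothesis G_ge0 : forall x, 0 <= G x.

(** The intervals vary with [k], so the integrands are extended by zero: a time [t < T] is
    eventually below [T_ k], and lower semicontinuity of [G] at [c t] bounds the pointwise lower
    limit. *)
Lemma cost_lsc (c_ : nat -> R -> X) c (T_ : nat -> R) (T : R) (M : \bar R) :
  (forall k, lip1 (c_ k)) -> lip1 c ->
  (forall t, c_ k t @[k --> \oo] --> c t) -> (T_ k @[k --> \oo] --> T)%R ->
  (\forall k \near \oo, cost G (c_ k) 0 (T_ k) <= M) -> cost G c 0 T <= M.
Proof.
move=> lc_ lc cc TT HM; have mG := lsc_borel G_lsc.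
pose f k t := ((G \o c_ k) \_ `]0%R, T_ k[) t.
have f0 k t : 0 <= f k t by apply: erestrict_ge0 => s _ /=.
apply: (@le_trans _ _ (\int[lebesgue_measure]_t limn_einf (f ^~ t))).
  rewrite /cost integral_mkcond; apply: ge0_le_integral => //.
  - by move=> t _; apply: erestrict_ge0 => s _ /=.
  - apply/(measurable_restrictT _ _).1 => //; apply: measurable_funTS.
    exact: (measurable_along mG lc).
  - under eq_fun do rewrite -[limn_einf _]oppeK -limn_esupN.
    apply: measurableT_comp => //; apply: measurable_fun_limn_esup => k.
    apply: measurableT_comp => //.
    apply/(measurable_restrictT _ _).1 => //; apply: measurable_funTS.
    exact: (measurable_along mG (lc_ k)).
  move=> t _; rewrite patchE; case: ifPn => [|_]; last first.
    by apply: limn_einf_ge; apply: nearW => k; exact: f0.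
  rewrite inE/= in_itv/= => /andP[t0 tT].
  apply: lee_dense => a aG; apply: limn_einf_ge.
  have nT : \forall k \near \oo, (t < T_ k)%R by apply: (cvgr_gt T TT).
  have nG : \forall k \near \oo, a%:E < G (c_ k t).
    by have := cc t [set x | a%:E < G x]; apply; apply: open_nbhs_nbhs; split.
  apply: filterS2 nT nG => k tk ak.
  by rewrite /f patchE ifT ?ltW// inE/= in_itv/= t0.
apply: le_trans (fatou _ _ _ _) _ => //.
  move=> k; apply/(measurable_restrictT _ _).1 => //; apply: measurable_funTS.
  exact: (measurable_along mG (lc_ k)).
apply: limn_einf_le; apply: filterS HM => k; apply: le_trans.
rewrite /cost [leRHS]integral_mkcond.
exact: lexx.
Qed.

End CostLsc.

(** * Compactness of 1-Lipschitz curves *)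

Section Subsequence.
Context {R : realType} {X : pmetricType R}.
Implicit Types (c : R -> X).

Lemma ultra_pigeonhole (I : eqType) (S : set_system nat) (zs : seq I)
    (Q : I -> set nat) : UltraFilter S ->
  S [set n | exists2 z, z \in zs & Q z n] -> exists2 z, z \in zs & S (Q z).
Proof.
move=> US; elim: zs => [|z zs ih] H.
  exfalso; apply: (@filter_not_empty _ S); apply: filterS H => n [z].
  by rewrite in_nil.
have [Qz|nQz] := in_ultra_setVsetC (Q z) US; first by exists z; rewrite ?mem_head.
have [|w wzs Qw] := ih.
  apply: filterS2 nQz H => n nQn [w]; rewrite inE => /predU1P[->//|wzs Qw].
  by exists w.
by exists w => //; rewrite inE wzs orbT.
Qed.

(* A diagonal argument, where an ultrafilter makes coherent choices: its element
   [P k] consists of indices of curves that are uniformly [4 / (k + 1)]-close. *)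
Lemma lip1_subsequence (A : set X) (M : R) (c_ : nat -> R -> X) (T_ : nat -> R) :
  complete_subset A -> 0 <= M ->
  (forall n, lip1 (c_ n)) -> (forall n t, A (c_ n t)) ->
  (forall n, 0 <= T_ n <= M) -> (forall n t, c_ n t = c_ n (clamp 0 M t)) ->
  (forall e : R, 0 < e -> exists zs : seq X, \forall n \near \oo, forall t,
     exists2 z, z \in zs & mdist z (c_ n t) < e) ->
  exists (s : nat -> nat) c (T : R), [/\ lip1 c, 0 <= T, forall k, (k <= s k)%N,
    forall t, c_ (s k) t @[k --> \oo] --> c t & T_ (s k) @[k --> \oo] --> T].
Proof.
move=> cA M0 lc Ac TM cM tot.
(* [S] refines [\oo], so each of its members meets every tail. *)
have [S [US ooS]] := @ultraFilterLemma nat \oo _.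
have P_ (k : nat) : exists2 P, S P & forall n m, P n -> P m ->
    (forall t, mdist (c_ n t) (c_ m t) <= 4 / k.+1%:R) /\
    `|T_ n - T_ m| <= 4 / k.+1%:R.
  pose e : R := k.+1%:R^-1; have e0 : 0 < e by rewrite invr_gt0.
  have [zs zsH] := tot e e0.
  have Szs i : exists z, S [set n | mdist z (c_ n (i%:R * e)) < e].
    have [|z _ Sz] := @ultra_pigeonhole X S zs
      (fun z => [set n | mdist z (c_ n (i%:R * e)) < e]) US.
      by apply: ooS; apply: filterS zsH => n /(_ (i%:R * e)).
    by exists z.
  have /choice[z zP] := Szs.
  pose N := (Num.truncn (M / e)).+1.
  have grid t : 0 <= t <= M -> exists2 i : nat, (i < N)%N & `|t - i%:R * e| <= e.
    move=> /andP[t0 tM]; exists (Num.truncn (t / e)).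
      by rewrite ltnS le_truncn// ler_pM2r// invr_gt0.
    have te0 : 0 <= t / e by rewrite divr_ge0// ltW.
    have /andP[] := truncn_itv te0.
    rewrite ler_pdivlMr// => h1; rewrite ltr_pdivrMr// -natr1 mulrDl mul1r => h2.
    by rewrite ger0_norm ?subr_ge0//; lra.
  have Sall m : S [set n | forall i, (i < m)%N -> mdist (z i) (c_ n (i%:R * e)) < e].
    elim: m => [|m ih]; first by apply: filterS filterT.
    apply: filterS2 ih (zP m) => n H1 H2 i; rewrite ltnS leq_eqVlt.
    by case/predU1P => [->//|]; exact: H1.
  have [|j _ Sj] := @ultra_pigeonhole nat S (iota 0 N)
      (fun i => [set n | `|T_ n - i%:R * e| <= e]) US.
    apply: filterS filterT => n _; have [i iN Ti] := grid _ (TM n).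
    by exists i => //; rewrite mem_iota.
  exists ([set n | forall i, (i < N)%N -> mdist (z i) (c_ n (i%:R * e)) < e] `&`
      [set n | `|T_ n - j%:R * e| <= e]); first exact: filterI.
  move=> n m [n1 n2] [m1 m2]; rewrite -/e; split; last first.
    rewrite (_ : T_ n - T_ m = (T_ n - j%:R * e) - (T_ m - j%:R * e)); last by lra.
    rewrite (le_trans (ler_normB _ _))// (le_trans (lerD n2 m2))//; lra.
  move=> t; rewrite (cM n) (cM m); have t01 := clamp_itv t M0.
  (* Four steps of length at most [e], through the two curves at the grid time and their common net
     point [z i], give the constant 4. *)
  have [i iN it] := grid _ t01; set s := clamp 0 M t in it *.
  have H1 := n1 i iN; have H2 := m1 i iN.
  have H3 := le_trans (lc n s (i%:R * e)) it.
  have H4 := le_trans (lc m (i%:R * e) s) (eq_ind _ (fun x => x <= e) it _ (distrC _ _)).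
  have := metric_triangle (c_ n s) (c_ n (i%:R * e)) (c_ m s).
  have := metric_triangle (c_ n (i%:R * e)) (z i) (c_ m s).
  have := metric_triangle (z i) (c_ m (i%:R * e)) (c_ m s).
  rewrite (metric_sym (c_ n (i%:R * e)) (z i)).
  have -> : (4 / k.+1%:R = 4 * e)%R by [].
  by lra.
have /choice[P PP] : forall k : nat, exists P : set nat, S P /\
    forall n m, P n -> P m ->
    (forall t, mdist (c_ n t) (c_ m t) <= 4 / k.+1%:R) /\
    `|T_ n - T_ m| <= 4 / k.+1%:R.
  by move=> k; have [Q SQ HQ] := P_ k; exists Q.
(* The diagonal choice: [s k] lies in [P 0], ..., [P k] at once, so all later terms are close to it
   at scale [4 / k.+1]. *)
have /choice[s sP] : forall k, exists n, (k <= n)%N /\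
    forall j, (j <= k)%N -> P j n.
  move=> k; have : S ([set n | (k <= n)%N] `&` [set n | forall j, (j < k.+1)%N -> P j n]).
    apply: filterI; first by apply: ooS; exists k.
    elim: k.+1 => [|m ih]; first by apply: filterS filterT.
    apply: filterS2 ih (proj1 (PP m)) => n H1 H2 i; rewrite ltnS leq_eqVlt.
    by case/predU1P => [->//|]; exact: H1.
  by move=> /filter_ex[n [kn H]]; exists n.
have close k l : (k <= l)%N -> (forall t, mdist (c_ (s k) t) (c_ (s l) t) <= 4 / k.+1%:R) /\
    `|T_ (s k) - T_ (s l)| <= 4 / k.+1%:R.
  by move=> kl; apply: (proj2 (PP k)); [exact: (proj2 (sP k))|exact: (proj2 (sP l))].
have small e : 0 < e -> exists k : nat, 4 / k.+1%:R < e :> R.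
  move=> e0; have e4 : 0 < e / 4 by rewrite divr_gt0.
  have [k _ /(_ k (leqnn _))/= kH] := near_infty_natSinv_lt (PosNum e4).
  by exists k; rewrite mulrC -ltr_pdivlMr.
have /choice[c cP] : forall t : R, exists x : X, c_ (s k) t @[k --> \oo] --> x.
  move=> t; have [//||x _ cx] := cA (fun k => c_ (s k) t); last by exists x.
  apply: cauchy_exP => e e0; have [k ke] := small _ e0.
  exists (c_ (s k) t); exists k => // l /= kl; rewrite ballEmdist/=.
  exact: le_lt_trans ((close k l kl).1 t) ke.
have [T TT] : exists T : R, T_ (s k) @[k --> \oo] --> T.
  apply/cvg_ex/cauchy_cvgP; apply: cauchy_exP => e e0; have [k ke] := small _ e0.
  exists (T_ (s k)); exists k => // l /= kl; rewrite -ball_normE/=.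
  exact: le_lt_trans ((close k l kl).2) ke.
exists s, c, T; split => //.
- move=> u v; apply/ler_addgt0Pr => e e0; have e2 : 0 < e / 2 by rewrite divr_gt0.
  have [k [h1 h2]] : exists k, mdist (c u) (c_ (s k) u) < e / 2 /\
      mdist (c v) (c_ (s k) v) < e / 2.
    apply: (@filter_ex _ \oo); apply: filterI.
      exact: (metricType_numDomainType.cvgr_dist_lt (cP u) e2).
    exact: (metricType_numDomainType.cvgr_dist_lt (cP v) e2).
  rewrite (metric_sym (c v)) in h2; rewrite (splitr e) addrCA.
  rewrite (le_trans (metric_triangle _ (c_ (s k) u) _))//; apply: lerD (ltW h1) _.
  rewrite (le_trans (metric_triangle _ (c_ (s k) v) _))//.
  exact: lerD (lc _ _ _) (ltW h2).
- rewrite -(cvg_lim _ TT)//; apply: limr_ge; first by apply/cvg_ex; exists T.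
  by apply: nearW => k; case/andP: (TM (s k)).
- by move=> k; case: (sP k).
Qed.

End Subsequence.

(** * The potential as the value of a control problem *)

Section Potential.
Context {R : realType} {X : pmetricType R}.
Implicit Types (c : R -> X).
Variables (phi : X -> R) (G : X -> \bar R).
Local Open Scope ereal_scope.

(** The largest function below [phi] with upper gradient [G], by [pot_le], [curve_ug_pot] and
    [le_pot]. *)
Definition pot (x : X) : \bar R := ereal_inf [set r | exists c (a b : R),
  [/\ lip1 c, (a <= b)%R, c a = x & r = (phi (c b))%:E + cost G c a b]].

Hypothesis phi_ge0 : forall x, (0 <= phi x)%R.
Hypotheses (mG : measurable_fun [set: borel X] G) (G_ge0 : forall x, 0 <= G x).

Lemma pot_ge0 x : 0 <= pot x.
Proof.
apply: le_ereal_inf_tmp => _ [c [a [b [_ _ _ ->]]]].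
by rewrite adde_ge0 ?lee_fin// cost_ge0.
Qed.

Lemma pot_le_curve c (a b : R) : lip1 c -> (a <= b)%R ->
  pot (c a) <= (phi (c b))%:E + cost G c a b.
Proof. by move=> lc ab; apply: ereal_inf_lbound; exists c, a, b. Qed.

Lemma pot_le x : pot x <= (phi x)%:E.
Proof.
have lx : lip1 (fun=> x) by move=> s t; rewrite mdistxx.
by have := pot_le_curve lx (lexx 0%R); rewrite costxx adde0.
Qed.

Lemma pot_fin x : pot x \is a fin_num.
Proof. by rewrite ge0_fin_numE ?pot_ge0// (le_lt_trans (pot_le x))// ltry. Qed.

(** Every competitor from [c b], preceded by [c] on [[a, b]], is a competitor from [c a]. *)
Lemma pot_step c (a b : R) : lip1 c -> (a <= b)%R ->
  pot (c a) <= pot (c b) + cost G c a b.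
Proof.
move=> lc ab; have [->|coo] := eqVneq (cost G c a b) +oo.
  by rewrite addey ?leey// gt_eqF// (lt_le_trans _ (pot_ge0 _)).
have cfin : cost G c a b \is a fin_num.
  by rewrite ge0_fin_numE ?cost_ge0// ltey.
rewrite -leeBlDr//; apply: le_ereal_inf_tmp => _ [e [d [d' [le dd' ed ->]]]].
rewrite leeBlDr// -addeA.
have lE := lip1_concat lc le (esym ed).
set E := (fun t => _) in lE.
have bd : (b <= b + (d' - d))%R by rewrite lerDl subr_ge0.
have Ea : E a = c a by rewrite /E ab.
have Eb : E (b + (d' - d))%R = e d'.
  rewrite /E; case: ifPn => [|_]; last by congr e; lra.
  rewrite -[leRHS]addr0 lerD2l subr_le0 => d'd.
  have -> : d' = d by apply/eqP; rewrite eq_le d'd dd'.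
  by rewrite subrr addr0 ed.
rewrite -Ea -Eb; apply: le_trans (pot_le_curve lE (le_trans ab bd)) _.
rewrite leeD2l// -(costD mG G_ge0 lE ab bd) addeC; apply: leeD.
  rewrite (@eq_cost _ _ G E (fun t => e (t + (d - b))%R)); last first.
    by move=> t /andP[bt _]; rewrite /E leNgt bt/=; congr e; lra.
  apply: le_trans (cost_shift mG G_ge0 _ _ _ le) _.
  have -> : (b + (d - b) = d)%R by lra.
  by have -> : (b + (d' - d) + (d - b) = d')%R by lra.
by rewrite (@eq_cost _ _ G E c)// => t /andP[_ tb]; rewrite /E ltW.
Qed.

Lemma pot_step_rev c (a b : R) : lip1 c -> (a <= b)%R ->
  pot (c b) <= pot (c a) + cost G c a b.
Proof.
move=> lc ab; have lr : lip1 (fun t => c (- t)%R).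
  by apply: lip1_comp => // s t; rewrite -opprD normrN.
have ba : (- b <= - a)%R by rewrite lerN2.
have := pot_step lr ba; rewrite !opprK => /le_trans; apply.
by rewrite leeD2l// cost_rev.
Qed.

Lemma curve_ug_pot : curve_ug (fine \o pot) G.
Proof.
move=> c a b lc ab; have [->|coo] := eqVneq (cost G c a b) +oo; first exact: leey.
have cfin : cost G c a b \is a fin_num by rewrite ge0_fin_numE ?cost_ge0// ltey.
rewrite -(fineK cfin) lee_fin ler_norml /= -lerBlDr opprK.
rewrite -!(lee_fin) !EFinD !EFinN !fineK ?pot_fin//.
apply/andP; split; first by rewrite addeC leeBlDr//; exact: pot_step.
by rewrite leeBlDl ?pot_fin//; exact: pot_step_rev.
Qed.

Lemma le_pot (f : X -> R) x : curve_ug f G -> (forall y, (f y <= phi y)%R) ->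
  (f x)%:E <= pot x.
Proof.
move=> ug fphi; apply: le_ereal_inf_tmp => _ [c [a [b [lc ab <- ->]]]].
apply: (@le_trans _ _ ((f (c b))%:E + `|f (c b) - f (c a)|%:E)).
  rewrite -EFinD lee_fin -lerBlDl; apply: le_trans (ler_norm _) _.
  by rewrite distrC.
by apply: leeD; [rewrite lee_fin|exact: ug].
Qed.

End Potential.

Section PotentialLsc.
Context {R : realType} {X : pmetricType R}.
Implicit Types (c : R -> X) (x y z : X).
Variables (phi : X -> R) (G : X -> \bar R) (U A : set X).
Local Open Scope ereal_scope.
Hypothesis phi_ge0 : forall x, (0 <= phi x)%R.
Hypothesis phi_lsc : forall a : R, open [set x | (a < phi x)%R].
Hypothesis phi_out : forall x, ~ U x -> phi x = 0%R.
Hypothesis G_ge0 : forall x, 0 <= G x.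
Hypothesis G_lsc : forall a : R, open [set x | a%:E < G x].
Hypothesis G_ge1 : forall x, U x -> 1 <= G x.
Hypothesis U_open : open U.
Hypothesis A_complete : complete_subset A.
Hypothesis U_sub : forall y, (forall e : R, (0 < e)%R ->
  exists2 z, U z & (mdist y z < e)%R) -> A y.
Hypothesis U_tot : forall e : R, (0 < e)%R -> exists zs : seq X, forall y, U y ->
  (exists2 z, z \in zs & (mdist z y < e)%R) \/ e^-1%:E <= G y.

Let mG := lsc_borel G_lsc.

(* A competitor is stopped when it leaves [U], where [phi] vanishes. *)
Let stopped_competitor x (M : R) : U x -> pot phi G x < M%:E ->
  exists c (T : R), [/\ lip1 c, (0 <= T)%R, c 0%R = x,
    (forall t, (0 <= t < T)%R -> U (c t)) &
    (phi (c T))%:E + cost G c 0 T < M%:E].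
Proof.
move=> Ux /ereal_inf_lt[_ [c0 [a [b [lc0 ab c0a ->]]]] cM].
pose c t := c0 (t + a)%R.
have lc : lip1 c by apply: lip1_comp => // s t; rewrite opprD addrACA subrr addr0.
have ba : (0 <= b - a)%R by rewrite subr_ge0.
have cM' : (phi (c (b - a)%R))%:E + cost G c 0 (b - a) < M%:E.
  apply: le_lt_trans cM; rewrite /c subrK leeD2l//.
  have := cost_shift mG G_ge0 0 (b - a) a lc0.
  by rewrite add0r subrK.
have [inU|[s [/andP[s0 sb] nU inU]]] := first_exit lc U_open ba.
  exists c, (b - a)%R; split => //; first by rewrite /c add0r.
  by move=> t /andP[t0 tb]; apply: inU; rewrite t0 ltW.
exists c, s; split => //; first by rewrite /c add0r.
apply: le_lt_trans cM'; rewrite phi_out//.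
by apply: leeD; [rewrite lee_fin|exact: cost_subset].
Qed.

(** As [G >= 1] on [U], cost bounds time; the curves of bounded cost thus share a compact parameter
    interval. *)
Let duration c (T M : R) : lip1 c -> (0 <= T)%R ->
  (forall t, (0 <= t < T)%R -> U (c t)) -> cost G c 0 T <= M%:E -> (T <= M)%R.
Proof.
move=> lc T0 inU cM; rewrite -lee_fin; apply: le_trans cM.
apply: (@le_trans _ _ (cost (cst 1) c 0 T)).
  by rewrite /cost integral_cst//= mul1e lebesgue_measure_itv/= lte_fin;
    case: ltP => [_|T0']; rewrite ?sube0// lee_fin.
apply: cost_le => // t /andP[t0 tT]; apply: G_ge1; apply: inU.
by rewrite (ltW t0).
Qed.

(* The cost of a curve bounds the time that it spends away from [zs]. *)
Let near_net c (T M e : R) (zs : seq X) (t : R) : lip1 c -> (0 <= T)%R -> (0 < e)%R ->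
  (0 < M)%R -> (forall t, (0 <= t < T)%R -> U (c t)) -> cost G c 0 T <= M%:E ->
  (forall y, U y -> (exists2 z, z \in zs & (mdist z y < e)%R) \/ e^-1%:E <= G y) ->
  (0 <= t <= T)%R ->
  exists2 z, z \in c 0%R :: zs & (mdist z (c t) < (2 * M + 1) * e)%R.
Proof.
move=> lc T0 e0 M0 inU cM net /andP[t0 tT].
(* If the curve avoided the net during the time [d] before [t], this alone would cost at least
   [d / e = 2 * M]. Times up to [d] are close to the start, hence the extra point [c 0]. *)
pose d := (2 * M * e)%R; have d0 : (0 < d)%R by rewrite !mulr_gt0.
have [td|dt] := leP t d.
  exists (c 0%R); first exact: mem_head.
  apply: (le_lt_trans (lc _ _)); rewrite sub0r normrN ger0_norm//.
  by apply: (le_lt_trans td); rewrite mulrDl mul1r -/d ltrDl.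
have [[s [/andP[s1 s2] [z zzs zs_]]]|H] := pselect (exists s, (t - d < s < t)%R /\
    exists2 z, z \in zs & (mdist z (c s) < e)%R).
  exists z; first by rewrite inE zzs orbT.
  apply: (le_lt_trans (metric_triangle _ (c s) _)).
  rewrite mulrDl mul1r addrC; apply: ler_ltD => //.
  apply: (le_trans (lc _ _)); rewrite distrC gtr0_norm ?subr_gt0// -/d; lra.
exfalso; have ei0 : 0 <= e^-1%:E by rewrite lee_fin invr_ge0 ltW.
have : e^-1%:E * d%:E <= M%:E.
  apply: le_trans cM; apply: (@le_trans _ _ (cost (cst e^-1%:E) c (t - d) t)).
    rewrite /cost integral_cst//= lebesgue_measure_itv/= lte_fin.
    by rewrite ifT -?EFinB; [rewrite opprB addrC subrK|lra].
  apply: (@le_trans _ _ (cost G c (t - d) t)).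
    apply: cost_le => // s /andP[s1 s2].
    have Us : U (c s) by apply: inU; apply/andP; split; lra.
    by case: (net _ Us) => // zz; exfalso; apply: H; exists s; rewrite s1.
  by apply: cost_subset => //; lra.
have -> : e^-1%:E * d%:E = (2 * M)%:E by rewrite -EFinM mulrC mulfK// gt_eqF.
by rewrite lee_fin; lra.
Qed.

Lemma pot_lsc (a : R) : open [set x | a%:E < pot phi G x].
Proof.
rewrite openE => x /= ax; have [a0|a0] := ltP a 0%R.
  apply: filterS filterT => y _ /=.
  by apply: (lt_le_trans _ (pot_ge0 phi_ge0 G_ge0 y)); rewrite lte_fin.
(* Off [U] the potential is at most [phi = 0], so only points of [U] matter. *)
have Ux : U x.
  apply: contrapT => nU; move: ax; rewrite ltNge => /negP; apply.
  by apply: (le_trans (pot_le _ _ _)); rewrite phi_out// lee_fin.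
have /nbhs_ballP[r0 /= r00 r0U] : nbhs x U by apply: open_nbhs_nbhs.
apply: contrapT => nball.
pose d (n : nat) : R := Num.min r0 (n.+1%:R^-1)%R.
have d0 n : (0 < d n)%R by rewrite lt_min r00 invr_gt0/=.
have /choice[x_ xP] : forall n, exists y, (mdist x y < d n)%R /\ pot phi G y <= a%:E.
  move=> n; apply: contrapT => nex; apply: nball.
  apply/nbhs_ballP; exists (d n); [exact: d0|move=> y]; rewrite ballEmdist/= => xy.
  by rewrite ltNge; apply/negP => ya; apply: nex; exists y.
have xU n : U (x_ n).
  apply: r0U; rewrite ballEmdist/=; have [xd _] := xP n.
  by apply: (lt_le_trans xd); rewrite /d ge_min lexx.
have /choice[cT cTP] n : exists cT : (R -> X) * R, [/\ lip1 cT.1, (0 <= cT.2)%R, cT.1 0%R = x_ n,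
    (forall t, (0 <= t < cT.2)%R -> U (cT.1 t)) &
    (phi (cT.1 cT.2))%:E + cost G cT.1 0 cT.2 < (a + n.+1%:R^-1)%R%:E].
  have [|c [T H]] := @stopped_competitor (x_ n) (a + n.+1%:R^-1)%R (xU n).
    by have [_ xa] := xP n; apply: (le_lt_trans xa); rewrite lte_fin ltrDl invr_gt0.
  by exists (c, T).
pose M := (a + 1)%R; have M0 : (0 < M)%R by rewrite ltr_wpDl.
have costM n : cost G (cT n).1 0 (cT n).2 <= M%:E.
  have [_ _ _ _ H] := cTP n.
  apply: (@le_trans _ _ (a + n.+1%:R^-1)%R%:E); last first.
    by rewrite lee_fin lerD2l invf_le1// ler1n.
  apply: le_trans (ltW H); rewrite leeDr// lee_fin.
  exact: phi_ge0.
pose T_ n := (cT n).2.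
pose c_ n t := (cT n).1 (clamp 0 (T_ n) t).
have T0 n : (0 <= T_ n)%R by case: (cTP n).
have TM n : (T_ n <= M)%R.
  by have [lc _ _ inU _] := cTP n; exact: (duration lc (T0 n) inU (costM n)).
have lc_ n : lip1 (c_ n).
  have [lc _ _ _ _] := cTP n; apply: lip1_comp => // s t; exact: clamp_lip.
(* At its final time the curve may sit on the boundary of [U]. The point at the slightly earlier
   time [s'] is in [U], which puts [c_ n t] in the closure of [U] and so in [A]. *)
have cA n t : A (c_ n t).
  rewrite /c_; have /andP[] := clamp_itv t (T0 n); set s := clamp _ _ _ => s0 sT.
  have [lc _ c0 inU _] := cTP n; rewrite -/(T_ n) in inU.
  apply: U_sub => e e0; have [T00|T00] := leP (T_ n) 0%R.
    exists (x_ n) => //; have -> : s = 0%R.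
      by apply/eqP; rewrite eq_le s0 (le_trans sT T00).
    by rewrite c0 mdistxx.
  pose s' := Num.max 0%R (s - Num.min (e / 2) (T_ n / 2))%R.
  have e2 : (0 < e / 2)%R by rewrite divr_gt0.
  have T2 : (0 < T_ n / 2)%R by rewrite divr_gt0.
  have m0 : (0 < Num.min (e / 2) (T_ n / 2))%R by rewrite lt_min e2 T2.
  have me : (Num.min (e / 2) (T_ n / 2) <= e / 2)%R by rewrite ge_min lexx.
  exists ((cT n).1 s').
    apply: inU; rewrite le_max lexx/= gt_max T00/=; lra.
  apply: (le_lt_trans (lc _ _)); rewrite /s'.
  case: (leP 0%R (s - Num.min (e / 2) (T_ n / 2))%R) => h.
    by rewrite opprB addrC subrK gtr0_norm//; lra.
  by rewrite subr0 ger0_norm//; lra.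
have cclamp n t : c_ n t = c_ n (clamp 0 M t).
  by rewrite /c_ clamp_clamp.
have xx : forall e : R, (0 < e)%R -> \forall n \near \oo, (mdist x (x_ n) < e)%R.
  move=> e e0; have [N _ NH] := near_infty_natSinv_lt (PosNum e0).
  exists N => // n /= Nn; have [h _] := xP n; apply: (lt_trans h).
  by rewrite /d gt_min NH ?orbT.
have tot (e : R) : (0 < e)%R -> exists zs : seq X, \forall n \near \oo, forall t,
    exists2 z, z \in zs & (mdist z (c_ n t) < e)%R.
  (* [near_net] loses the factor [2 * M + 1], and another [e / 2] pays for replacing the starting
     points [x_ n] by their limit [x]. *)
  move=> e0; pose e1 := (e / 2 / (2 * M + 1))%R.
  have M1 : (0 < 2 * M + 1)%R by rewrite addr_gt0// mulr_gt0.
  have e2 : (0 < e / 2)%R by rewrite divr_gt0.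
  have e10 : (0 < e1)%R by rewrite divr_gt0.
  have [zs net] := U_tot e10; exists (x :: zs).
  apply: filterS (xx _ e2) => n xn t.
  have [lc _ c0 inU _] := cTP n.
  have [z] := near_net lc (T0 n) e10 M0 inU (costM n) net (clamp_itv t (T0 n)).
  rewrite /e1 mulrC divfK ?gt_eqF// c0 inE => /predU1P[->|zzs] h.
    exists x; first exact: mem_head.
    by rewrite (splitr e) (le_lt_trans (metric_triangle _ (x_ n) _))// ltrD.
  exists z; first by rewrite inE zzs orbT.
  by apply: (lt_trans h); lra.
have T0M n : (0 <= T_ n <= M)%R by rewrite T0 TM.
have [s [c [T [lc T00 ks cvc cvT]]]] :=
  lip1_subsequence A_complete (ltW M0) lc_ cA T0M cclamp tot.
have s_oo : forall P : set nat, (\forall n \near \oo, P n) -> \forall k \near \oo, P (s k).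
  by move=> P [N _ NP]; exists N => // k /= Nk; apply: NP => /=; exact: leq_trans (ks k).
have c0x : c 0%R = x.
  apply: mdist_positivity; apply/eqP; rewrite eq_le mdist_ge0 andbT.
  apply/ler_addgt0Pl => e e0; rewrite addr0; have e2 : (0 < e / 2)%R by rewrite divr_gt0.
  have [k [h1 h2]] : exists k, (mdist (c 0%R) (c_ (s k) 0%R) < e / 2)%R /\
      (mdist x (x_ (s k)) < e / 2)%R.
    apply: (@filter_ex _ \oo); apply: filterI.
      exact: (metricType_numDomainType.cvgr_dist_lt (cvc 0%R) e2).
    exact: (s_oo _ (xx _ e2)).
  have [_ _ c0 _ _] := cTP (s k).
  have h3 : c_ (s k) 0%R = x_ (s k) by rewrite /c_ clamp_id ?lexx ?T0.
  rewrite h3 in h1; rewrite (metric_sym x) in h2; rewrite (splitr e).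
  apply: (le_trans (metric_triangle _ (x_ (s k)) _)).
  by rewrite lerD ?(ltW h1) ?(ltW h2).
have cTlim : c_ (s k) (T_ (s k)) @[k --> \oo] --> c T.
  apply/metricType_numDomainType.cvgrPdist_lt => e e0.
  have e2 : (0 < e / 2)%R by rewrite divr_gt0.
  have h1 : \forall k \near \oo, (mdist (c T) (c_ (s k) T) < e / 2)%R.
    exact: (metricType_numDomainType.cvgr_dist_lt (cvc T) e2).
  have h2 : \forall k \near \oo, (`|T - T_ (s k)| < e / 2)%R.
    by have /cvgrPdist_lt := cvT; exact.
  apply: filterS2 h1 h2 => k k1 k2; rewrite (splitr e).
  apply: (le_lt_trans (metric_triangle _ (c_ (s k) T) _)); apply: ltrD => //.
  exact: le_lt_trans (lc_ _ _ _) k2.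
have stop n : (phi (c_ n (T_ n)))%:E + cost G (c_ n) 0 (T_ n) < (a + n.+1%:R^-1)%R%:E.
  have [lcn _ _ _ H] := cTP n; apply: le_lt_trans H.
  rewrite /c_ clamp_id ?lexx ?T0//= (@eq_cost _ _ G _ (cT n).1)//.
  by move=> t /andP[t0 tT]; rewrite clamp_id// !ltW.
suff : pot phi G x <= a%:E by rewrite leNgt ax.
rewrite -c0x; apply: (le_trans (pot_le_curve phi G lc T00)).
(* As [phi] is only lower semicontinuous at the end of the limit curve, a value [b] below
   [phi (c T)] is eventually exceeded, which leaves [a - b] for the cost; then [b] tends to
   [phi (c T)]. *)
have : forall b : R, (b < phi (c T))%R -> cost G c 0 T <= (a - b)%:E.
  move=> b bphi; apply/lee_addgt0Pr => e e0; rewrite -EFinD.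
  apply: (cost_lsc G_lsc G_ge0 (fun k => lc_ (s k)) lc cvc cvT).
  have h1 : \forall k \near \oo, (b < phi (c_ (s k) (T_ (s k))))%R.
    by have := cTlim [set y | (b < phi y)%R]; apply; apply: open_nbhs_nbhs; split.
  have h2 : \forall k \near \oo, ((s k).+1%:R^-1 < e)%R.
    exact: (s_oo (fun n => n.+1%:R^-1 < e)%R (near_infty_natSinv_lt (PosNum e0))).
  apply: filterS2 h1 h2 => k k1 k2.
  have := stop (s k); rewrite -lteBrDl// -EFinB => /ltW/le_trans; apply.
  by rewrite lee_fin [leRHS]addrAC lerB ?lerD2l// ltW.
move=> H; have cfin : cost G c 0 T \is a fin_num.
  rewrite ge0_fin_numE ?cost_ge0//; apply: (le_lt_trans (H (phi (c T) - 1)%R _)).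
    by rewrite ltrBlDr ltrDl.
  by rewrite ltry.
rewrite -(fineK cfin) -EFinD lee_fin -lerBrDr; apply/ler_addgt0Pr => e e0.
have := H (phi (c T) - e)%R; rewrite ltrBlDr ltrDl e0 => /(_ isT).
rewrite -[X in X <= _](fineK cfin) lee_fin.
have aux (u v w : R) : (u <= a - (v - w) -> v <= a - u + w)%R by lra.
exact: aux.
Qed.

End PotentialLsc.

(** * Local lower semicontinuous approximation *)

Section PowerR.
Context {R : realType}.
Local Open Scope ereal_scope.
Implicit Types (x y : \bar R) (r : R).

Lemma le_poweR x y r : (0 <= r)%R -> 0 <= x -> x <= y -> x `^ r <= y `^ r.
Proof.
move=> r0 x0 xy; apply: gt0_ler_poweR => //; rewrite in_itv/= leey andbT//.
exact: le_trans xy.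
Qed.

Lemma poweRK x r : (0 < r)%R -> 0 <= x -> (x `^ r) `^ r^-1 = x.
Proof. by move=> r0 x0; rewrite -poweRrM divff ?gt_eqF// poweRe1. Qed.

Lemma poweRVK x r : (0 < r)%R -> 0 <= x -> (x `^ r^-1) `^ r = x.
Proof. by move=> r0 x0; rewrite -poweRrM mulVf ?gt_eqF// poweRe1. Qed.

Lemma lsc_root (T : topologicalType) (h : T -> \bar R) r : (0 < r)%R ->
  (forall t, 0 <= h t) -> (forall a : R, open [set t | a%:E < h t]) ->
  forall a : R, open [set t | a%:E < h t `^ r^-1].
Proof.
move=> r0 h0 hlsc a; have rV0 : (0 <= r^-1)%R by rewrite invr_ge0 ltW.
have [a0|a0] := ltP a 0%R.
  rewrite (_ : mkset _ = setT); first exact: openT.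
  rewrite -subTset => x _ /=; apply: (@lt_le_trans _ _ 0); first by rewrite lte_fin.
  exact: poweR_ge0.
rewrite (_ : mkset _ = [set t | (a `^ r)%:E < h t]); first exact: hlsc.
apply/seteqP; split => x /=; rewrite !ltNge; apply: contraNN => H.
  by rewrite -(@poweRK a%:E r)// ?lee_fin// poweR_EFin le_poweR.
rewrite -(@poweRVK (h x) r)// -poweR_EFin; apply: le_poweR => //.
- exact: ltW.
- exact: poweR_ge0.
Qed.

End PowerR.

(** The sandwich is symmetric under complements, stable under countable unions, and supplies
    measurable bounds on both sides. *)
Lemma completed_sandwich d (T : measurableType d) (R : realType)
    (mu : {measure set T -> \bar R}) (S : set T) : completed_algebra_gen mu S ->
  exists P Q, [/\ measurable P, measurable Q, P `<=` S, S `<=` Q &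
    mu (Q `\` P) = 0%E].
Proof.
move=> [P mP [N [Z [mZ Z0 NZ]]] <-]; exists P, (P `|` Z); split => //.
- exact: measurableU.
- exact: setUS.
- apply/eqP; rewrite eq_le measure_ge0 andbT -Z0; apply: le_measure; rewrite ?inE//.
    by apply: measurableD => //; exact: measurableU.
  by move=> x [[]].
Qed.

Section Separable.
Context {R : realType} {X : pmetricType R}.

Lemma separable_seq : separable_space X ->
  exists z : nat -> X, forall x (e : R), 0 < e -> exists n, mdist (z n) x < e.
Proof.
move=> [D /countable_injP[f finj] dD].
exists (fun n => xget point [set y | D y /\ f y = n]) => x e e0.
have [] := dD (ball x e).
- by exists x; exact: ballxx.
- exact: mball_open.
move=> y []; rewrite ballEmdist/= => xy Dy; exists (f y).
case: xgetP => [w _ [Dw fw]|]; last by move=> /(_ y); case.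
by rewrite (finj w y) ?inE// metric_sym.
Qed.

(** By density the complements of finitely many of the balls decrease to the empty set, and [mu U]
    is finite. This is the substitute for total boundedness of [U]. *)
Lemma finite_net_measure (mu : {measure set (borel X) -> \bar R}) (z : nat -> X)
    (U : set X) (e eta : R) :
  (forall x (d : R), 0 < d -> exists n, mdist (z n) x < d) ->
  open U -> (mu U < +oo)%E -> 0 < e -> 0 < eta ->
  exists N, (mu (U `\` \bigcup_(i < N) ball (z i) e) < eta%:E)%E.
Proof.
move=> zd oU muU e0 eta0; have mU := borel_open oU.
pose F N := ~` (\bigcup_(i < N) ball (z i) e).
have [N FN] : exists N, (mrestr mu mU (F N) < eta%:E)%E.
  apply: (bigcap_measure_lt (finite_setT_mrestr mU muU)) => //.
  - move=> N; apply: measurableC; apply: borel_open.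
    by apply: bigcup_open => i _; exact: mball_open.
  - move=> m n mn; apply/subsetPset; apply: subsetC; apply: bigcup_subset.
    by move=> i /= /leq_trans; exact.
  rewrite (_ : \bigcap_n F n = set0) ?measure0 ?lte_fin//.
  rewrite -subset0 => x xF; have [n zn] := zd x _ e0.
  by apply: (xF n.+1 I); exists n => //=; rewrite ballEmdist.
by exists N; rewrite setDE setIC.
Qed.

End Separable.

Section LocalApproximation.
Context {R : realType} {X : pmetricType R}.
Local Open Scope ereal_scope.

(* The weight exceeds [2 ^ j] off a finite union of balls of radius [2 ^ - j];
   a curve of bounded cost can then be covered by few small balls. *)
Lemma confining_weight (mu : {measure set (borel X) -> \bar R}) (z : nat -> X)
    (U : set X) (p K : R) (g : X -> \bar R) :
  (forall x (d : R), (0 < d)%R -> exists n, (mdist (z n) x < d)%R) ->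
  open U -> mu U < +oo -> (1 <= p)%R -> (0 <= K)%R ->
  measurable_fun [set: borel X] g -> (forall x, 0 <= g x) ->
  \int[mu]_(x in U) g x `^ p < +oo ->
  exists G : X -> \bar R, [/\ forall a : R, open [set x | a%:E < G x],
    forall x, 0 <= G x, forall x, U x -> g x <= G x /\ K%:E <= G x,
    forall e : R, (0 < e)%R -> exists zs : seq X, forall y, U y ->
      (exists2 z, z \in zs & (mdist z y < e)%R) \/ e^-1%:E <= G y &
    \int[mu]_(x in U) G x `^ p < +oo].
Proof.
move=> zd oU muU p1 K0 mg g0 gp; have mU := borel_open oU.
have p0 : (0 < p)%R by exact: lt_le_trans p1.
(* The p-th power of the height [2 ^ j]. Dividing the allowed measure by [W j] makes the total
   energy of the heights at most 1. *)
pose W (j : nat) : R := ((2 ^+ j) `^ p)%R.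
have W0 j : (0 < W j)%R by rewrite powR_gt0// exprn_gt0.
have eta0 j : (0 < 1 / (2 ^ j.+1)%:R / W j)%R by rewrite !divr_gt0// ltr0n expn_gt0.
have r0 j : (0 < (2 ^+ j)^-1 :> R)%R by rewrite invr_gt0 exprn_gt0.
have /choice[N NP] j := finite_net_measure zd oU muU (r0 j) (eta0 j).
pose F j := U `\` \bigcup_(i < N j) ball (z i) ((2 ^+ j)^-1)%R.
have mF j : measurable (F j : set (borel X)).
  apply: measurableD => //; apply: borel_open.
  by apply: bigcup_open => i _; exact: mball_open.
pose s (j : nat) (x : borel X) : \bar R := (W j * \1_(F j) x)%:E.
have s0 j x : 0 <= s j x by rewrite lee_fin mulr_ge0// ltW.
have ms j : measurable_fun setT (s j).
  by apply/measurable_EFinP; apply: measurable_funM => //; exact: measurable_indic.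
(* The majorant is taken of a sum of p-th powers, as [lsc_majorant] controls an integral; its p-th
   root then dominates each contribution. *)
pose f x := g x `^ p + ((K `^ p)%:E + \sum_(j <oo) s j x).
have ss0 x : 0 <= \sum_(j <oo) s j x by apply: nneseries_ge0.
have mgp : measurable_fun [set: borel X] (fun x => g x `^ p).
  by apply: (measurableT_comp (measurable_poweR p)).
have Kp0 : 0 <= (K `^ p)%:E by rewrite lee_fin powR_ge0.
have f0 x : 0 <= f x by rewrite !adde_ge0// poweR_ge0.
have mss : measurable_fun [set: borel X] (fun x => \sum_(j <oo) s j x).
  exact: ge0_emeasurable_sum.
have mf : measurable_fun [set: borel X] f.
  by apply: emeasurable_funD => //; apply: emeasurable_funD.
have foo : \int[mu]_(x in U) f x < +oo.
  rewrite ge0_integralD//; last 4 first.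
  - by move=> x _; exact: poweR_ge0.
  - exact: measurable_funTS.
  - by move=> x _; rewrite adde_ge0.
  - by apply: measurable_funTS; exact: emeasurable_funD.
  apply: lte_add_pinfty => //; rewrite ge0_integralD//; last exact: measurable_funTS.
  apply: lte_add_pinfty.
    by rewrite integral_cst//= lte_mul_pinfty.
  rewrite integral_nneseries//; last by move=> j; exact: measurable_funTS.
  apply: (@le_lt_trans _ _ (\sum_(k <oo) (1 / (2 ^ k.+1)%:R)%:E)); last first.
    by apply: (le_lt_trans (epsilon_trick0 predT ler01)); rewrite ltry.
  apply: lee_nneseries => [j _ _|j _]; first exact: integral_ge0.
  rewrite /s; under eq_integral do rewrite EFinM.
  rewrite ge0_integralZl//; last 2 first.
  - by apply/measurable_EFinP; apply: measurable_funTS; exact: measurable_indic.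
  - by rewrite lee_fin ltW.
  rewrite integral_indic//.
  rewrite (_ : 1 / _ = W j * (1 / (2 ^ j.+1)%:R / W j))%R; last first.
    by rewrite [RHS]mulrC divfK// gt_eqF.
  rewrite EFinM lee_wpmul2l ?lee_fin ?(ltW (W0 j))// setIidl; last by move=> x [].
  exact: ltW (NP j).
have [h [hlsc h0 fh hoo]] := lsc_majorant oU muU mf f0 foo.
have pV0 : (0 <= p^-1)%R by rewrite invr_ge0 ltW.
have root x y : U x -> 0 <= y -> y `^ p <= f x -> y <= h x `^ p^-1.
  move=> Ux y0 yf; rewrite -(@poweRK _ y p)//; apply: le_poweR => //.
    exact: poweR_ge0.
  exact: le_trans yf (fh _ Ux).
exists (fun x => h x `^ p^-1); split.
- exact: lsc_root.
- by move=> x; exact: poweR_ge0.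
- move=> x Ux; split; apply: root => //; first by rewrite leeDl// adde_ge0.
  rewrite poweR_EFin /f addeCA; apply: leeDl.
  by rewrite adde_ge0// poweR_ge0.
- move=> e e0; pose j := (Num.truncn e^-1).+1.
  have je : (e^-1 <= 2 ^+ j :> R)%R.
    apply: (@le_trans _ _ j%:R); first by rewrite ltW// truncnS_gt.
    by rewrite -natrX ler_nat ltnW// ltn_expl.
  exists [seq z i | i <- iota 0 (N j)] => y Uy.
  have [[i /= iN zy]|nF] := pselect ((\bigcup_(i < N j) ball (z i) ((2 ^+ j)^-1)%R) y).
    left; exists (z i); first by apply/mapP; exists i => //; rewrite mem_iota.
    move: zy; rewrite ballEmdist/= => /lt_le_trans; apply.
    by rewrite invf_ple ?posrE ?exprn_gt0.
  right; apply: (@le_trans _ _ (2 ^+ j)%:E); first by rewrite lee_fin.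
  apply: root => //; rewrite poweR_EFin -/(W j) /f addeA.
  apply: (@le_trans _ _ (\sum_(j <oo) s j y)); last first.
    by rewrite leeDr// adde_ge0// poweR_ge0.
  have -> : (W j)%:E = s j y by rewrite /s indicE mem_set ?mulr1//; split.
  rewrite (@nneseriesD1 _ _ j)//.
  by rewrite leeDl//; apply: nneseries_ge0.
- under eq_integral do rewrite poweRVK//.
  exact: hoo.
Qed.

(** The set where [u] exceeds the level [k * del] is enlarged to an open set [V k], on which [phi]
    is at least [k.+1 * del], one step higher so that [phi >= u]. The excess lies in the differences
    of [V k] and [P k], which need not be open; [B] covers them by open sets, as gluing along curves
    requires. *)
Lemma lsc_levels (nu : {measure set (borel X) -> \bar R}) (U : set X) (u : X -> R)
    (M eps del : R) : nu setT < +oo -> open U -> (0 < eps)%R -> (0 < del)%R ->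
  (forall x, (0 <= u x <= M)%R) -> (forall x, ~ U x -> u x = 0%R) ->
  (forall a : R, exists P Q : set (borel X), [/\ measurable P, measurable Q,
    P `<=` [set x | (a < u x)%R], [set x | (a < u x)%R] `<=` Q &
    nu (Q `\` P) = 0]) ->
  exists (phi : X -> R) (B : set X),
    [/\ forall a : R, open [set x | (a < phi x)%R],
        forall x, (u x <= phi x <= M + del)%R, forall x, ~ U x -> phi x = 0%R,
        forall x, ~ B x -> (phi x <= u x + del)%R &
        [/\ open B, B `<=` U & nu B <= eps%:E]].
Proof.
move=> nuT oU eps0 del0 uM u_out sand.
have mU := borel_open oU.
pose n := (Num.truncn (M / del)).+1.
have M0 : (0 <= M)%R by case/andP: (uM point) => /le_trans; exact.
have MN : (M <= n%:R * del)%R.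
  by rewrite -ler_pdivrMr// ltW// truncnS_gt.
have NM : (n%:R * del <= M + del)%R.
  rewrite -natr1 mulrDl mul1r lerD2r -ler_pdivlMr//.
  have Md : (0 <= M / del)%R by rewrite divr_ge0// ltW.
  by case/andP: (truncn_itv Md).
(* Each of the [n] levels contributes measure at most [2 * eta] to [B]. *)
pose eta := (eps / 2 / n%:R)%R; have eta0 : (0 < eta)%R by rewrite !divr_gt0.
have /choice[P /choice[Q PQ]] k := sand (k%:R * del)%R.
have /choice[V0 V0P] : forall k : nat, exists V : set X, [/\ open V, Q k `<=` V & nu (V `\` Q k) < eta%:E].
  by move=> k; apply: outer_regular => //; case: (PQ k).
pose V k := V0 k `&` U.
have oV k : open (V k) by apply: openI => //; case: (V0P k).
have mV k := borel_open (oV k).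
have mP k : measurable (P k : set (borel X)) by case: (PQ k).
have mQ k : measurable (Q k : set (borel X)) by case: (PQ k).
have mVP k : measurable (V k `\` P k : set (borel X)) by exact: measurableD.
have nuVP k : nu (V k `\` P k) < eta%:E.
  have [oV0 QV0 V0eta] := V0P k; have [_ _ PS SQ QP0] := PQ k.
  apply: le_lt_trans V0eta; rewrite -[leRHS]adde0 -QP0.
  have mV0 := borel_open oV0.
  have m1 : measurable (V0 k `\` Q k : set (borel X)) by exact: measurableD.
  have m2 : measurable (Q k `\` P k : set (borel X)) by exact: measurableD.
  apply: le_trans (measureU2 nu m1 m2); apply: le_measure; rewrite ?inE//.
    exact: measurableU.
  move=> x [[V0x Ux] nPx]; have [Qx|nQx] := pselect (Q k x); [right|left]; split => //.
have /choice[B0 B0P] : forall k, exists B : set X, [/\ open B, V k `\` P k `<=` B & nu (B `\` (V k `\` P k)) < eta%:E].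
  by move=> k; exact: outer_regular.
have nuB0 k : nu (B0 k) <= (eta + eta)%:E.
  have [oB VPB Beta] := B0P k; have mB := borel_open oB.
  have m1 : measurable (B0 k `\` (V k `\` P k) : set (borel X)) by exact: measurableD.
  apply: (@le_trans _ _ (nu (B0 k `\` (V k `\` P k)) + nu (V k `\` P k))).
    apply: le_trans (measureU2 nu m1 (mVP k)); apply: le_measure; rewrite ?inE//.
      exact: measurableU.
    by move=> x Bx; have [h|h] := pselect ((V k `\` P k) x); [right|left].
  by rewrite EFinD leeD// ltW.
pose B := U `&` \bigcup_(k < n) B0 k.
have oB : open B.
  by apply: openI => //; apply: bigcup_open => k _; case: (B0P k).
pose phi x := \big[Num.max/0%R]_(k < n) (if x \in V k then k.+1%:R * del else 0)%R.
have term0 x k : (0 <= (if x \in V k then k.+1%:R * del else 0))%R.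
  by case: ifP => // _; rewrite mulr_ge0// ltW.
have phi0 x : (0 <= phi x)%R by apply: bigmax_ge_id.
have phiP x (a : R) : (0 <= a)%R -> (a < phi x)%R ->
    exists2 k : 'I_n, V k x & (a < k.+1%:R * del)%R.
  move=> a0 /bigmax_gtP[|[k _]]; first by rewrite ltNge a0.
  by case: ifPn => [/set_mem Vx ak|_]; [exists k|rewrite ltNge a0].
have phi_ge x (k : nat) : (k < n)%N -> V k x -> (k.+1%:R * del <= phi x)%R.
  move=> kn Vx; apply: (@le_trans _ _ (if x \in V (Ordinal kn) then k.+1%:R * del else 0)%R).
    by rewrite mem_set.
  exact: (le_bigmax _ (fun k : 'I_n => if x \in V k then k.+1%:R * del else 0)%R).
exists phi, B; split.
- move=> a; have [a0|a0] := ltP a 0%R.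
    rewrite (_ : mkset _ = setT); first exact: openT.
    by rewrite -subTset => x _ /=; exact: lt_le_trans (phi0 x).
  rewrite (_ : mkset _ = \bigcup_(k in [set k | (k < n)%N /\ (a < k.+1%:R * del)%R]) V k).
    by apply: bigcup_open.
  apply/seteqP; split => x /=.
    by move/(phiP _ _ a0) => [k Vk ak]; exists k.
  by move=> [k /= [kn ak] Vx]; exact: lt_le_trans ak (phi_ge x k kn Vx).
- move=> x; have /andP[u0 uxM] := uM x; apply/andP; split; last first.
    apply: le_trans NM; apply: bigmax_le; first by rewrite mulr_ge0// ltW.
    move=> k _; case: ifP => _; last by rewrite mulr_ge0// ltW.
    by rewrite ler_wpM2r ?(ltW del0)// ler_nat.
  have [ux0|ux0] := leP (u x) 0%R; first exact: le_trans (phi0 x).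
  have [k [kn ku uk]] : exists k : nat, [/\ (k < n)%N, (k%:R * del < u x)%R & (u x <= k.+1%:R * del)%R].
    have ex : exists k : nat, (u x <= k.+1%:R * del)%R.
      by exists n.-1; rewrite prednK//; exact: le_trans MN.
    have [k uk kmin] := ex_minnP ex; exists k.
    have ku : (k%:R * del < u x)%R.
      case: k {uk} kmin => [|k] kmin; first by rewrite mul0r.
      by rewrite ltNge; apply/negP => /kmin; rewrite ltnn.
    split => //; rewrite -(ltr_nat R) -(ltr_pM2r del0).
    by apply: (lt_le_trans ku); exact: le_trans MN.
  apply: (le_trans uk); apply: phi_ge => //; split; last first.
    by apply: contrapT => /u_out ux; rewrite ux ltxx in ux0.
  have [_ QV0 _] := V0P k; apply: QV0; have [_ _ _ SQ _] := PQ k; exact: SQ.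
- move=> x nUx; apply/eqP; rewrite eq_le phi0 andbT leNgt; apply/negP.
  by move/(phiP _ _ (lexx _)) => [k [_ /nUx]].
- move=> x nBx; have /andP[u0 _] := uM x; rewrite leNgt; apply/negP.
  move/(phiP x (u x + del)%R); case; first by rewrite addr_ge0// ltW.
  move=> k Vx; rewrite -natr1 mulrDl mul1r ltrD2r => uk; apply: nBx; split; first by case: Vx.
  exists k => //=; have [_ VPB _] := B0P k; apply: VPB; split => // Px.
  have [_ _ PS _ _] := PQ k; have /= := PS _ Px.
  by rewrite ltNge (ltW uk).
- split => //; first by move=> x [].
  apply: (@le_trans _ _ (\sum_(k < n) nu (B0 k))).
    apply: (@le_trans _ _ (nu (\big[setU/set0]_(k < n) B0 k))).
      apply: le_measure; rewrite ?inE; first exact: borel_open.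
        by apply: bigsetU_measurable => k _; apply: borel_open; case: (B0P k).
      by rewrite -bigcup_mkord => x [].
    apply: (@content_subadditive _ _ _ nu _ B0 n) => //.
    - by move=> k _; apply: borel_open; case: (B0P k).
    - by apply: bigsetU_measurable => k _; apply: borel_open; case: (B0P k).
  apply: (@le_trans _ _ (\sum_(k < n) (eta + eta)%:E)); first by apply: lee_sum => k _.
  have -> : (eta + eta = eps / n%:R)%R by rewrite /eta -mulrDl -splitr.
  rewrite sumEFin lee_fin sumr_const card_ord -[X in (X <= _)%R]mulr_natr.
  by rewrite divfK// pnatr_eq0.
Qed.

End LocalApproximation.

Lemma dist_min_le_max (R : realDomainType) (x y x' y' : R) :
  `|Num.min x y - Num.min x' y'| <= Num.max `|x - x'| `|y - y'|.
Proof.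
set m := Num.max `|_| _.
have : `|x - x'| <= m by rewrite /m le_max lexx.
have : `|y - y'| <= m by rewrite /m le_max lexx orbT.
rewrite !ler_norml => /andP[h1 h2] /andP[h3 h4].
by case: (leP x y) => ?; case: (leP x' y') => ?; apply/andP; split; lra.
Qed.

Lemma dist_max_le_max (R : realDomainType) (x y x' y' : R) :
  `|Num.max x y - Num.max x' y'| <= Num.max `|x - x'| `|y - y'|.
Proof.
set m := Num.max `|_| _.
have : `|x - x'| <= m by rewrite /m le_max lexx.
have : `|y - y'| <= m by rewrite /m le_max lexx orbT.
rewrite !ler_norml => /andP[h1 h2] /andP[h3 h4].
by case: (leP x y) => ?; case: (leP x' y') => ?; apply/andP; split; lra.
Qed.

(** * Potentials on a ball *)

Section LocalPotential.
Context {R : realType} {X : pmetricType R}.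
Local Open Scope ereal_scope.

Lemma curve_ug_lipschitz (f : X -> R) (K : R) : (0 <= K)%R ->
  (forall x y, `|f x - f y| <= K * mdist x y)%R -> curve_ug f (cst K%:E).
Proof.
move=> K0 fK c a b lc; rewrite le_eqVlt => /predU1P[->|ab].
  by rewrite subrr normr0 costxx.
rewrite /cost integral_cst//= lebesgue_measure_itv/= lte_fin ab -EFinB -EFinM lee_fin.
apply: (le_trans (fK _ _)); rewrite ler_wpM2l//; apply: (le_trans (lc _ _)).
by rewrite ger0_norm// subr_ge0 ltW.
Qed.

Lemma curve_ug_min (f1 f2 : X -> R) (g1 g2 : X -> \bar R) :
  measurable_fun [set: borel X] g1 -> (forall x, 0 <= g1 x) ->
  measurable_fun [set: borel X] g2 -> (forall x, 0 <= g2 x) ->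
  curve_ug f1 g1 -> curve_ug f2 g2 ->
  curve_ug (fun x => Num.min (f1 x) (f2 x)) (fun x => maxe (g1 x) (g2 x)).
Proof.
move=> mg1 g10 mg2 g20 ug1 ug2 c a b lc ab.
have mm : measurable_fun [set: borel X] (fun x => maxe (g1 x) (g2 x)).
  exact: measurable_maxe.
have le1 : `|f1 (c b) - f1 (c a)|%:E <= cost (fun x => maxe (g1 x) (g2 x)) c a b.
  apply: le_trans (ug1 _ _ _ lc ab) _; apply: cost_le => // t _.
  by rewrite le_max lexx.
have le2 : `|f2 (c b) - f2 (c a)|%:E <= cost (fun x => maxe (g1 x) (g2 x)) c a b.
  apply: le_trans (ug2 _ _ _ lc ab) _; apply: cost_le => // t _.
  by rewrite le_max lexx orbT.
apply: (@le_trans _ _ (Num.max `|f1 (c b) - f1 (c a)| `|f2 (c b) - f2 (c a)|)%R%:E).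
  by rewrite lee_fin dist_min_le_max.
by rewrite EFin_max ge_max le1.
Qed.

Lemma curve_ug_max (f1 f2 : X -> R) (g1 g2 : X -> \bar R) :
  measurable_fun [set: borel X] g1 -> (forall x, 0 <= g1 x) ->
  measurable_fun [set: borel X] g2 -> (forall x, 0 <= g2 x) ->
  curve_ug f1 g1 -> curve_ug f2 g2 ->
  curve_ug (fun x => Num.max (f1 x) (f2 x)) (fun x => maxe (g1 x) (g2 x)).
Proof.
move=> mg1 g10 mg2 g20 ug1 ug2 c a b lc ab.
have mm : measurable_fun [set: borel X] (fun x => maxe (g1 x) (g2 x)).
  exact: measurable_maxe.
have le1 : `|f1 (c b) - f1 (c a)|%:E <= cost (fun x => maxe (g1 x) (g2 x)) c a b.
  apply: le_trans (ug1 _ _ _ lc ab) _; apply: cost_le => // t _.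
  by rewrite le_max lexx.
have le2 : `|f2 (c b) - f2 (c a)|%:E <= cost (fun x => maxe (g1 x) (g2 x)) c a b.
  apply: le_trans (ug2 _ _ _ lc ab) _; apply: cost_le => // t _.
  by rewrite le_max lexx orbT.
apply: (@le_trans _ _ (Num.max `|f1 (c b) - f1 (c a)| `|f2 (c b) - f2 (c a)|)%R%:E).
  by rewrite lee_fin dist_max_le_max.
by rewrite EFin_max ge_max le1.
Qed.

Lemma lipschitz_superlevel_open (f : X -> R) (K a : R) : (0 < K)%R ->
  (forall x y, `|f x - f y| <= K * mdist x y)%R -> open [set x | (a < f x)%R].
Proof.
move=> K0 fK; rewrite openE => x /= ax; apply/nbhs_ballP.
exists ((f x - a) / K)%R; first by rewrite /= divr_gt0// subr_gt0.
move=> y; rewrite ballEmdist/= ltr_pdivlMr// mulrC => xy.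
have := le_lt_trans (fK x y) xy; have := ler_norm (f x - f y)%R; lra.
Qed.

(** The function is cut off by a Lipschitz bump so that it vanishes off the ball and competitors can
    be stopped there; hence [w] dominates [u] only on the half ball. [A] contains the closure of the
    ball, where limits of curves lie. *)
Lemma local_approximation (mu : {measure set (borel X) -> \bar R}) (z : nat -> X)
    (x0 : X) (r : R) (A : set X) (p M eps del : R) (u : X -> R) (g : X -> \bar R) :
  (forall x (d : R), (0 < d)%R -> exists n, (mdist (z n) x < d)%R) ->
  complete_subset A -> (0 < r)%R -> ball x0 (2 * r)%R `<=` A ->
  mu (ball x0 r) < +oo -> (1 <= p)%R -> (0 < eps)%R -> (0 < del)%R ->
  (forall x, (0 <= u x <= M)%R) ->
  (forall a : R, completed_algebra_gen mu [set x | (a < u x)%R]) ->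
  curve_ug u g -> measurable_fun [set: borel X] g -> (forall x, 0 <= g x) ->
  \int[mu]_x g x `^ p < +oo ->
  exists (w : X -> R) (G : X -> \bar R) (B : set X),
    [/\ [/\ forall a : R, open [set x | (a < w x)%R],
          forall x, (0 <= w x <= M + del)%R & curve_ug w G],
        measurable_fun [set: borel X] G /\ (forall x, 0 <= G x),
        forall x, ball x0 (r / 2)%R x -> (u x <= w x)%R,
        forall x, ~ B x -> (w x <= u x + del)%R &
        [/\ open B, \int[mu]_(x in B) G x `^ p <= eps%:E & mu B <= eps%:E]].
Proof.
move=> zd cA r0 x0A muU p1 eps0 del0 uM mu_u ug mg g0 gp.
have p0 : (0 < p)%R by exact: lt_le_trans p1.
set U := ball x0 r in muU; have oU : open U by exact: mball_open.
have mU := borel_open oU.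
have M0 : (0 <= M)%R by case/andP: (uM point) => /le_trans; exact.
(* The slope [2 * M / r] raises the bump to [M] on the half ball; the added 1 yields [G >= K >= 1]
   on [U]. *)
pose K := (2 * M / r + 1)%R.
have K1 : (1 <= K)%R by rewrite lerDr// divr_ge0 ?mulr_ge0// ltW.
have K0 : (0 < K)%R by exact: lt_le_trans K1.
have mgp : measurable_fun [set: borel X] (fun x => g x `^ p).
  by apply: (measurableT_comp (measurable_poweR p)).
have gpU : \int[mu]_(x in U) g x `^ p < +oo.
  apply: le_lt_trans gp; apply: ge0_subset_integral => //.
  by move=> x _; exact: poweR_ge0.
have [G [Glsc G0 GU Gtot GpU]] :=
  confining_weight zd oU muU p1 (ltW K0) mg g0 gpU.
have mG := lsc_borel Glsc.
pose cut x := clamp 0 M (K * (r - mdist x0 x))%R.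
have cutK x y : (`|cut x - cut y| <= K * mdist x y)%R.
  apply: (le_trans (clamp_lip _ _ _ _)); rewrite -mulrBr normrM gtr0_norm//.
  rewrite ler_pM2l// ler_norml.
  have := metric_triangle x0 x y; have := metric_triangle x0 y x.
  by rewrite (metric_sym y x) => h1 h2; apply/andP; split; lra.
have cut0 x : (0 <= cut x)%R by case/andP: (clamp_itv (K * (r - mdist x0 x))%R M0).
pose u1 x := Num.min (u x) (cut x).
have u1M x : (0 <= u1 x <= M)%R.
  by have /andP[h1 h2] := uM x; rewrite /u1 le_min h1 cut0/= ge_min h2.
have u1_out x : ~ U x -> u1 x = 0%R.
  rewrite /U ballEmdist/= => /negP; rewrite -leNgt => rx.
  apply/eqP; rewrite eq_le; case/andP: (u1M x) => -> _; rewrite andbT.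
  rewrite /u1 ge_min /cut /clamp; apply/orP; right.
  rewrite max_l// ge_min; apply/orP; right.
  by rewrite pmulr_rle0// subr_le0.
have u1_in x : ball x0 (r / 2)%R x -> u1 x = u x.
  rewrite ballEmdist/= => x0x; rewrite /u1 min_l// /cut /clamp.
  have /andP[h1 h2] := uM x; rewrite le_max le_min h2/=; apply/orP; right.
  apply: (le_trans h2); apply: (@le_trans _ _ (2 * M / r * (r / 2)))%R.
    by rewrite [leRHS](_ : _ = M)//; field; rewrite gt_eqF.
  apply: ler_pM; [|by lra| by rewrite lerDl|by lra].
  by rewrite divr_ge0 ?mulr_ge0// ltW.
have mh : measurable_fun [set: borel X] (fun x => maxe (g x) (cst K%:E x)).
  exact: measurable_maxe.
(* [G] dominates [g] and [K] only on [U]; off [U] the function [u1] is zero, so it is glued with the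
   zero function. *)
have ug1 : curve_ug u1 G.
  apply: (@curve_ug_glue _ _ u1 (cst 0%R) (cst 0) (fun x => maxe (g x) (cst K%:E x)) G U) => //.
  - by move=> x; rewrite le_max g0.
  - by move=> c a b lc ab; rewrite subrr normr0 cost_ge0.
  - apply: curve_ug_min => //; first by move=> x; rewrite lee_fin ltW.
    exact: (curve_ug_lipschitz (ltW K0) cutK).
  - by move=> x Ux; have [h1 h2] := GU x Ux; rewrite ge_max h1 h2.
have mGp : measurable_fun [set: borel X] (fun x => G x `^ p).
  by apply: (measurableT_comp (measurable_poweR p)).
have Gp0 x : 0 <= G x `^ p by exact: poweR_ge0.
(* Smallness for [G ^ p mu] is smallness of energy, and also of measure because [G >= 1] on [U]. *)
pose nu : {measure set (borel X) -> \bar R} := mrestr (density mu mGp Gp0) mU.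
have nuE S : nu S = \int[mu]_(x in S `&` U) G x `^ p by [].
have nuT : nu setT < +oo by rewrite nuE setTI.
have sand (a : R) : exists P Q : set (borel X), [/\ measurable P, measurable Q,
    P `<=` [set x | (a < u1 x)%R], [set x | (a < u1 x)%R] `<=` Q & nu (Q `\` P) = 0].
  have [P [Q [mP mQ PS SQ QP0]]] := completed_sandwich (mu_u a).
  pose C := [set x | (a < cut x)%R].
  have oC : open C by exact: (lipschitz_superlevel_open a K0 cutK).
  have mC := borel_open oC.
  exists (P `&` C), (Q `&` C); split; [exact: measurableI|exact: measurableI|..].
  - by move=> x [/PS/= h1 h2]; rewrite /u1 lt_min h1.
  - by move=> x /=; rewrite /u1 lt_min => /andP[h1 h2]; split => //; exact: SQ.
  have mN : measurable (((Q `&` C) `\` (P `&` C)) `&` U : set (borel X)).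
    by apply: measurableI => //; apply: measurableD; exact: measurableI.
  rewrite nuE null_set_integral//; first exact: measurable_funTS.
  apply/eqP; rewrite eq_le measure_ge0 andbT -QP0; apply: le_measure; rewrite ?inE//.
    exact: measurableD.
  by move=> x [[[Qx Cx] nPC] _]; split => // Px; apply: nPC.
have [phi [B [phi_lsc phi_b phi_out phi_B [oB BU nuB]]]] :=
  lsc_levels nuT oU eps0 del0 u1M u1_out sand.
have phi0 x : (0 <= phi x)%R.
  by have /andP[h _] := phi_b x; have /andP[h' _] := u1M x; exact: le_trans h.
have G1 x : U x -> 1 <= G x.
  by move=> Ux; have [_ h] := GU x Ux; apply: le_trans h; rewrite lee_fin.
pose w x := fine (pot phi G x).
have potE x : pot phi G x = (w x)%:E by rewrite /w fineK// pot_fin.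
have wphi x : (w x <= phi x)%R by rewrite -lee_fin -potE pot_le.
exists w, G, B; split.
- split.
  + move=> a; have := @pot_lsc _ _ phi G U A phi0 phi_lsc phi_out G0 Glsc G1 oU cA _ Gtot a.
    rewrite (_ : mkset _ = [set x | (a < w x)%R]); last first.
      by apply/seteqP; split => x /=; rewrite potE lte_fin.
    apply => y yU; apply: x0A; have [t Ut yt] := yU r r0.
    rewrite ballEmdist/=; rewrite /U ballEmdist/= in Ut.
    by apply: (le_lt_trans (metric_triangle _ t _)); rewrite (metric_sym t); lra.
  + move=> x; apply/andP; split.
      by rewrite fine_ge0// pot_ge0.
    by apply: (le_trans (wphi x)); case/andP: (phi_b x).
  + exact: curve_ug_pot.
- by [].
- move=> x /u1_in <-; rewrite -lee_fin -potE; apply: le_pot => // y.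
  by case/andP: (phi_b y).
- move=> x nBx; apply: (le_trans (wphi x)); apply: (le_trans (phi_B x nBx)).
  by rewrite lerD2r ge_min lexx.
have nuBE : nu B = \int[mu]_(x in B) G x `^ p by rewrite nuE setIidl.
split => //; first by rewrite -nuBE.
apply: le_trans nuB; rewrite nuBE -[leLHS]mul1e -integral_cst; last exact: borel_open.
have mB := borel_open oB.
apply: ge0_le_integral => //; first exact: measurable_funTS.
move=> x Bx /=; rewrite -(poweR1r p) le_poweR//; first exact: ltW.
exact: G1 (BU _ Bx).
Qed.

End LocalPotential.

(** * Patching *)

Section Completion.
Context d (T : measurableType d) (R : realType).
Variable mu : {measure set T -> \bar R}.
Local Open Scope ereal_scope.
Local Notation completed := (completed_algebra_gen mu).

Lemma completed_of_sandwich (P Q S : set T) : measurable P -> measurable Q ->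
  P `<=` S -> S `<=` Q -> mu (Q `\` P) = 0 -> completed S.
Proof.
move=> mP mQ PS SQ QP0; exists P => //; exists (S `\` P); last exact: setDUK.
by exists (Q `\` P); split => //; [exact: measurableD|exact: setSD].
Qed.

Lemma completed_measurable (S : set T) : measurable S -> completed S.
Proof. by move=> mS; apply: (@completed_of_sandwich S S); rewrite ?setDv. Qed.

Lemma completed_sigma_algebra : sigma_algebra setT completed.
Proof.
split; first exact: completed_measurable.
- move=> S /completed_sandwich[P [Q [mP mQ PS SQ QP0]]]; rewrite setTD.
  apply: (@completed_of_sandwich (~` Q) (~` P)).
  + exact: measurableC.
  + exact: measurableC.
  + exact: subsetC.
  + exact: subsetC.
  + by rewrite setDE setCK setIC -setDE.
- move=> S cS.
  have /choice[P /choice[Q PQ]] i := completed_sandwich (cS i).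
  apply: (@completed_of_sandwich (\bigcup_i P i) (\bigcup_i Q i)).
  + by apply: bigcupT_measurable => i; case: (PQ i).
  + by apply: bigcupT_measurable => i; case: (PQ i).
  + by apply: subset_bigcup => i _; case: (PQ i).
  + by apply: subset_bigcup => i _; case: (PQ i).
  + apply: measure_negligible.
      by apply: measurableD; apply: bigcupT_measurable => i; case: (PQ i).
    apply: (@negligibleS _ _ _ mu (\bigcup_i (Q i `\` P i))).
      by move=> x [[i _ Qx] nP]; exists i => //; split => // Px; apply: nP; exists i.
    apply: negligible_bigcup => i; have [mP mQ _ _ QP0] := PQ i.
    by apply/negligibleP => //; exact: measurableD.
Qed.

Lemma completed_bigcup (S : (set T)^nat) :
  (forall i, completed (S i)) -> completed (\bigcup_i S i).
Proof. by case: completed_sigma_algebra => _ _; exact. Qed.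

Lemma completed_setU (S1 S2 : set T) : completed S1 -> completed S2 ->
  completed (S1 `|` S2).
Proof.
move=> c1 c2; rewrite -bigcup2E; apply: completed_bigcup => -[|[|i]] //=.
exact: completed_measurable.
Qed.

Lemma completed_fun (f : T -> \bar R) :
  (forall a : R, completed [set x | a%:E < f x]) ->
  forall Y : set (\bar R), measurable Y -> completed (f @^-1` Y).
Proof.
move=> cf; suff mf : measurable_fun [set: g_sigma_algebraType completed] f.
  move=> Y mY; have := mf measurableT Y mY; rewrite setTI.
  exact: (@smallest_sub _ (sigma_algebra setT) completed completed completed_sigma_algebra).
apply: (measurability _ (ErealGenOInfty.measurableE R)).
move=> /= _ [_ [a ->]] <-; rewrite setTI preimage_itvoy.
exact: sub_sigma_algebra.
Qed.

(* An integral is a supremum over measurable simple functions below the integrand;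
   upper bounds therefore go through a measurable modification of [f]. *)
Lemma completed_modification (f : T -> R) : (forall x, (0 <= f x)%R) ->
  (forall a : R, completed [set x | (a < f x)%R]) ->
  exists N : set T, [/\ measurable N, mu N = 0 &
    measurable_fun setT (fun x => f x * \1_(~` N) x)%R].
Proof.
move=> f0 cf.
(* Rational levels give countably many null sets; off their union [N] the set [f > q] coincides with
   the measurable set [P q]. *)
have /choice[P /choice[Q PQ]] (q : rat) := completed_sandwich (cf (ratr q)).
pose N := \bigcup_q (Q q `\` P q).
have mQP q : measurable (Q q `\` P q) by apply: measurableD; case: (PQ q).
have mN : measurable N by exact: bigcupT_measurable_rat.
exists N; split => //.
  apply: measure_negligible => //.
  have -> : N = \bigcup_n (if unpickle n is Some q then Q q `\` P q else set0).
    apply/seteqP; split => x.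
      by move=> [q _ h]; exists (pickle q); rewrite ?pickleK.
    by move=> [n _]; case: (unpickle n) => // q h; exists q.
  apply: negligible_bigcup => n; case: (unpickle n) => [q|]; last exact: negligible_set0.
  by apply/negligibleP => //; case: (PQ q).
apply: (measurability _ (RGenOInfty.measurableE R)) => /= _ [_ [a ->]] <-.
rewrite setTI preimage_itvoy.
have [a0|a0] := ltP a 0%R.
  rewrite (_ : mkset _ = setT)//.
  by rewrite -subTset => x _ /=; apply: (lt_le_trans a0); rewrite mulr_ge0.
rewrite (_ : mkset _ = \bigcup_(q in [set q : rat | (a <= ratr q)%R]) (P q `\` N)).
  rewrite bigcup_mkcond; apply: bigcupT_measurable_rat => q; case: ifP => // _.
  by apply: measurableD => //; case: (PQ q).
apply/seteqP; split => x /=.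
  rewrite indicE; case: (boolP (x \in ~` N)); last by rewrite mulr0 ltNge a0.
  rewrite inE mulr1 => nNx afx; have [q] := rat_in_itvoo afx.
  rewrite in_itv/= => /andP[aq qf]; exists q; first exact: ltW.
  split => //; apply: contrapT => nPx; apply: nNx; exists q => //; split => //.
  by have [_ _ _ SQ _] := PQ q; exact: SQ.
move=> [q /= aq [Pq nN]]; rewrite indicE mem_set// mulr1.
by apply: (le_lt_trans aq); have [_ _ PS _ _] := PQ q; exact: PS.
Qed.

(** Immediate from the integral as a supremum over simple functions; it serves for functions
    measurable only for the completion. *)
Lemma ge0_le_integral_nonmeasurable (f g : T -> \bar R) : (forall x, 0 <= f x) ->
  (forall x, f x <= g x) -> \int[mu]_x f x <= \int[mu]_x g x.
Proof.
move=> f0 fg; rewrite !ge0_integralTE// => [|x]; last exact: le_trans (fg x).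
apply: le_ereal_sup => _ [h hf <-]; exists h => // x.
exact: le_trans (hf x) (fg x).
Qed.

End Completion.

Section OpenEnlargement.
Context {R : realType} {X : pmetricType R}.
Variable mu : {measure set (borel X) -> \bar R}.
Local Open Scope ereal_scope.

Lemma curve_ug_scale (K : R) (f : X -> R) (g : X -> \bar R) : (0 <= K)%R ->
  measurable_fun [set: borel X] g -> (forall x, 0 <= g x) -> curve_ug f g ->
  curve_ug (fun x => K * f x)%R (fun x => K%:E * g x).
Proof.
move=> K0 mg g0 ug c a b lc ab; rewrite -mulrBr normrM ger0_norm// EFinM.
rewrite /cost ge0_integralZl//; first by rewrite lee_wpmul2l ?lee_fin// ug.
by apply: measurable_funTS; exact: (measurable_along mg lc).
Qed.

(** A finite cost bounds the increments of all [v_ i] at once, and the bound survives the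
    supremum. *)
Lemma curve_ug_sup (v_ : nat -> X -> R) (M : R) (G : X -> \bar R) :
  (forall x, 0 <= G x) -> (forall i x, (v_ i x <= M)%R) ->
  (forall i, curve_ug (v_ i) G) ->
  curve_ug (fun x => sup (range (v_^~ x))) G.
Proof.
move=> G0 vM ug c a b lc ab; have [->|Coo] := eqVneq (cost G c a b) +oo.
  exact: leey.
have Cfin : cost G c a b \is a fin_num by rewrite ge0_fin_numE ?cost_ge0// ltey.
have sup_le x y : (forall i, v_ i x <= v_ i y + fine (cost G c a b))%R ->
    (sup (range (v_^~ x)) <= sup (range (v_^~ y)) + fine (cost G c a b))%R.
  move=> H; apply: ge_sup; first by exists (v_ 0%N x), 0%N.
  move=> _ [i _ <-]; apply: (le_trans (H i)); rewrite lerD2r.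
  apply: ub_le_sup; last by exists i.
  by exists M => _ [j _ <-].
have H i : (`|v_ i (c b) - v_ i (c a)| <= fine (cost G c a b))%R.
  by rewrite -lee_fin fineK// ug.
have h1 : (sup (range (v_^~ (c b))) <= sup (range (v_^~ (c a))) + fine (cost G c a b))%R.
  by apply: sup_le => i; have := H i; rewrite ler_norml => /andP[_ h]; lra.
have h2 : (sup (range (v_^~ (c a))) <= sup (range (v_^~ (c b))) + fine (cost G c a b))%R.
  by apply: sup_le => i; have := H i; rewrite ler_norml => /andP[h _]; lra.
by rewrite -(fineK Cfin) lee_fin ler_norml; apply/andP; split; lra.
Qed.

(* Patch countably many local lower semicontinuous approximations [w i], lowered
   by [del] so that they exceed the function only on open sets [B i] on which all
   weights have small energy. *)
Lemma open_enlargement (p K eps : R) (f : X -> R) (g : X -> \bar R) :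
  locally_complete X -> separable_space X ->
  (forall x (r : R), (0 < r)%R -> mu (ball x r) < +oo) ->
  (1 <= p)%R -> (1 < K)%R -> (0 < eps)%R ->
  (forall x, (0 <= f x <= 1)%R) ->
  (forall a : R, completed_algebra_gen mu [set x | (a < f x)%R]) ->
  curve_ug f g -> measurable_fun [set: borel X] g -> (forall x, 0 <= g x) ->
  \int[mu]_x g x `^ p < +oo ->
  exists (O : set X) (v : X -> R) (G : X -> \bar R),
    [/\ open O /\ (forall x, (1 <= f x)%R -> O x),
      [/\ forall x, (0 <= v x)%R, forall x, O x -> (1 <= v x)%R &
        forall a : R, completed_algebra_gen mu [set x | (a < v x)%R]],
      [/\ measurable_fun [set: borel X] G, forall x, 0 <= G x & curve_ug v G],
      \int[mu]_x (v x)%:E `^ p <= (K `^ p)%:E * \int[mu]_x (f x)%:E `^ p + eps%:E &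
      \int[mu]_x G x `^ p <= (K `^ p)%:E * \int[mu]_x g x `^ p + eps%:E].
Proof.
move=> Xc Xs muB p1 K1 eps0 f01 mf ugf mg g0 gp.
have p0 : (0 < p)%R by exact: lt_le_trans p1.
have K0 : (0 < K)%R by exact: lt_trans K1.
have [z zd] := separable_seq Xs.
(* This makes room for the lowering: where [f = 1], the function [v0] equals [K], and
   [K - del = 1 + del] for the [del] chosen below. *)
pose v0 x := (K * f x)%R; pose g1 x := K%:E * g x.
have v0K x : (0 <= v0 x <= K)%R.
  have /andP[h1 h2] := f01 x; rewrite mulr_ge0 ?(ltW K0)//=.
  by rewrite -[leRHS]mulr1 ler_pM2l.
have mv0 (a : R) : completed_algebra_gen mu [set x | (a < v0 x)%R].
  rewrite (_ : mkset _ = [set x | (a / K < f x)%R])//.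
  by apply/seteqP; split => x /=; rewrite /v0 ltr_pdivrMr// mulrC.
have mg1 : measurable_fun [set: borel X] g1 by exact: measurable_funeM.
have g10 x : 0 <= g1 x by rewrite mule_ge0// lee_fin ltW.
have ugv0 : curve_ug v0 g1 by exact: curve_ug_scale (ltW K0) mg g0 ugf.
have powg1 x : g1 x `^ p = (K `^ p)%:E * g x `^ p.
  by rewrite /g1 poweRM ?lee_fin ?(ltW K0)// poweR_EFin.
have mpow (h : X -> \bar R) : measurable_fun [set: borel X] h ->
    measurable_fun [set: borel X] (fun x => h x `^ p).
  by move=> mh; apply: (measurableT_comp (measurable_poweR p)).
have intg1 : \int[mu]_x g1 x `^ p = (K `^ p)%:E * \int[mu]_x g x `^ p.
  under eq_integral do rewrite powg1.
  rewrite ge0_integralZl//; first exact: mpow.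
  - by move=> x _; exact: poweR_ge0.
  - by rewrite lee_fin powR_ge0.
have g1p : \int[mu]_x g1 x `^ p < +oo.
  by rewrite intg1 lte_mul_pinfty// lee_fin powR_ge0.
pose del := ((K - 1) / 2)%R; have del0 : (0 < del)%R by rewrite divr_gt0// subr_gt0.
(* [eta] bounds the energy of all weights and the measure of the exceptional set, on which the new
   function can be as large as [K]; hence the division. *)
pose eta := (eps / (K `^ p + 1))%R.
have Kp0 : (0 <= K `^ p)%R by exact: powR_ge0.
have eta0 : (0 < eta)%R by rewrite divr_gt0// ltr_wpDl.
(* An index codes a centre in the dense sequence and a radius; numbers that code no pair fall back
   on [(0, 0)], which only repeats a ball. *)
pose k_ (i : nat) : nat * nat := odflt (0%N, 0%N) (unpickle i).
pose c_ i := z (k_ i).1; pose r_ (i : nat) : R := ((k_ i).2.+1%:R^-1)%R.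
have r0 i : (0 < r_ i)%R by rewrite invr_gt0.
pose good i := exists2 A : set X, complete_subset A & ball (c_ i) (2 * r_ i)%R `<=` A.
have ei0 i : (0 < eta / (2 ^ i.+1)%:R)%R by rewrite divr_gt0// ltr0n expn_gt0.
have loc i : exists wGB : (X -> R) * (X -> \bar R) * set X,
    let w := wGB.1.1 in let G := wGB.1.2 in let B := wGB.2 in
    [/\ [/\ forall a : R, open [set x | (a < w x)%R],
          forall x, (0 <= w x <= K + del)%R & curve_ug w G],
        measurable_fun [set: borel X] G /\ (forall x, 0 <= G x),
        good i -> forall x, ball (c_ i) (r_ i / 2)%R x -> (v0 x <= w x)%R,
        forall x, ~ B x -> (w x <= v0 x + del)%R &
        [/\ open B, \int[mu]_(x in B) G x `^ p <= (eta / (2 ^ i.+1)%:R)%:E &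
          mu B <= (eta / (2 ^ i.+1)%:R)%:E]].
  have [[A cA cAB]|ngood] := pselect (good i).
    have [w [G [B [H1 H2 H3 H4 H5]]]] := local_approximation zd cA (r0 i) cAB
      (muB _ _ (r0 i)) p1 (ei0 i) del0 v0K mv0 ugv0 mg1 g10 g1p.
    by exists (w, G, B).
  (* Without a complete set around the doubled ball the zero function is taken, which after lowering
     never exceeds [v0]. *)
  exists (cst 0%R, cst 0, set0) => /=; split => //.
  - split => [a|x|c a b lc ab].
    + have [a0|a0] := ltP a 0%R.
        rewrite (_ : mkset _ = setT); first exact: openT.
        by rewrite -subTset.
      rewrite (_ : mkset _ = set0); first exact: open0.
      by rewrite -subset0 => x.
    + by rewrite lexx addr_ge0// ltW.
    + by rewrite subrr normr0 cost_ge0.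
  - by move=> x _; have /andP[h _] := v0K x; rewrite addr_ge0// ltW.
  - by split; [exact: open0|rewrite integral_set0 lee_fin ltW|rewrite measure0 lee_fin ltW].
have /choice[wGB wP] := loc.
pose w i := (wGB i).1.1; pose G_ i := (wGB i).1.2; pose B i := (wGB i).2.
have oB i : open (B i) by case: (wP i) => _ _ _ _ [].
have mB i := borel_open (oB i).
have mG_ i : measurable_fun [set: borel X] (G_ i) by case: (wP i) => _ [].
have G_0 i x : 0 <= G_ i x by case: (wP i) => _ [_ h] _ _ _; exact: h.
pose s (i : nat) (x : borel X) : \bar R := (G_ i x `^ p) * (\1_(B i) x)%:E.
have s0 i x : 0 <= s i x by rewrite mule_ge0 ?poweR_ge0.
have ms i : measurable_fun [set: borel X] (s i).
  apply: emeasurable_funM; first exact: mpow.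
  by apply/measurable_EFinP; exact: measurable_indic.
(* A sum of p-th powers: its root [G] dominates [g1] everywhere and [G_ i] on [B i], while the
   energies merely add up. *)
pose Gp x := g1 x `^ p + \sum_(i <oo) s i x.
have ss0 x : 0 <= \sum_(i <oo) s i x by apply: nneseries_ge0.
have Gp0 x : 0 <= Gp x by rewrite adde_ge0// poweR_ge0.
have mss : measurable_fun [set: borel X] (fun x => \sum_(i <oo) s i x).
  exact: ge0_emeasurable_sum.
have mGp : measurable_fun [set: borel X] Gp by apply: emeasurable_funD => //; exact: mpow.
pose G x := Gp x `^ p^-1.
have mG : measurable_fun [set: borel X] G.
  by apply: (measurableT_comp (measurable_poweR p^-1)).
have pV0 : (0 <= p^-1)%R by rewrite invr_ge0 ltW.
have root x y : 0 <= y -> y `^ p <= Gp x -> y <= G x.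
  move=> y0 yG; rewrite -(@poweRK _ y p)//; apply: le_poweR => //.
  exact: poweR_ge0.
have g1G x : g1 x <= G x by apply: root => //; rewrite leeDl.
have GG i x : B i x -> G_ i x <= G x.
  move=> Bx; apply: root => //; apply: (@le_trans _ _ (\sum_(i <oo) s i x)); last first.
    by rewrite leeDr// poweR_ge0.
  have -> : G_ i x `^ p = s i x by rewrite /s indicE mem_set ?mule1.
  rewrite (@nneseriesD1 _ _ i)// leeDl//.
  by apply: nneseries_ge0.
pose v_ i x := Num.max (v0 x) (w i x - del)%R.
pose v x := sup (range (v_^~ x)).
have v_K i x : (v_ i x <= K)%R.
  rewrite ge_max; have /andP[_ ->] := v0K x; rewrite lerBlDr.
  by have [[_ h _] _ _ _ _] := wP i; case/andP: (h x).
have v_ub x : has_ubound (range (v_^~ x)) by exists K => _ [i _ <-].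
have v_v i x : (v_ i x <= v x)%R by apply: ub_le_sup => //; exists i.
have v0v x : (v0 x <= v x)%R by apply: le_trans (v_v 0%N x); rewrite le_max lexx.
have vK x : (v x <= K)%R by apply: ge_sup; [exists (v_ 0%N x), 0%N|move=> _ [i _ <-]].
have v_ge0 x : (0 <= v x)%R by apply: le_trans (v0v x); case/andP: (v0K x).
have lt_v (a : R) x : (a < v x)%R -> exists i, (a < v_ i x)%R.
  move=> av; apply: contrapT => H; move: av; rewrite ltNge => /negP; apply.
  apply: ge_sup; first by exists (v_ 0%N x), 0%N.
  by move=> _ [i _ <-]; rewrite leNgt; apply/negP => h; apply: H; exists i.
have mv (a : R) : completed_algebra_gen mu [set x | (a < v x)%R].
  rewrite (_ : mkset _ = \bigcup_i ([set x | (a < v0 x)%R] `|` [set x | (a + del < w i x)%R])).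
    apply: completed_bigcup => i; apply: completed_setU => //.
    apply: completed_measurable; apply: borel_open.
    by have [[h _ _] _ _ _ _] := wP i; exact: h.
  apply/seteqP; split => x /=.
    move/lt_v => [i]; rewrite lt_max => /orP[h|h]; exists i => //; first by left.
    by right; rewrite /= -ltrBrDr.
  move=> [i _ [/= h|/= h]]; first exact: lt_le_trans (v0v x).
  by apply: lt_le_trans (v_v i x); rewrite lt_max ltrBrDr h orbT.
have ugv_ i : curve_ug (v_ i) G.
  have [[_ _ ugw] _ _ wB _] := wP i.
  have mm : measurable_fun [set: borel X] (fun x => maxe (g1 x) (G_ i x)).
    exact: measurable_maxe.
  apply: (@curve_ug_glue _ _ (v_ i) v0 g1 (fun x => maxe (g1 x) (G_ i x)) G (B i)) => //.
  - by move=> x; rewrite le_max g10.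
  - by move=> x; exact: poweR_ge0.
  - by move=> x nBx; rewrite /v_ max_l// lerBlDr wB.
  - apply: curve_ug_max => // c a b lc ab.
    by rewrite opprD addrACA subrr addr0; exact: ugw.
  - by move=> x Bx; rewrite ge_max g1G GG.
pose V := \bigcup_i [set x | (1 + del < w i x)%R].
exists V, v, G; split.
- split; first by apply: bigcup_open => i _; have [[h _ _] _ _ _ _] := wP i; exact: h.
  move=> x fx; have [A xA cA] := Xc x; have /nbhs_ballP[e /= e0 eA] := xA.
  (* The centre is within [r_ i / 2] of [x], so [x] is in the half ball, and the points of the
     doubled ball are within [5 / 2 * r_ i < e] of [x]. *)
  have e3 : (0 < e / 3)%R by rewrite divr_gt0.
  have [m _ /(_ m (leqnn _)) /= me] := near_infty_natSinv_lt (PosNum e3).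
  have r2 : (0 < (m.+1%:R^-1 / 2 : R))%R by rewrite divr_gt0// invr_gt0.
  have [k zk] := zd x _ r2.
  pose i := pickle (k, m).
  have ik : k_ i = (k, m) by rewrite /k_ /i pickleK.
  have ci : c_ i = z k by rewrite /c_ ik.
  have ri : r_ i = (m.+1%:R^-1)%R by rewrite /r_ ik.
  have gi : good i.
    exists A => // y; rewrite ci ri ballEmdist/= => zy; apply: eA; rewrite ballEmdist/=.
    have := metric_triangle x (z k) y; rewrite (metric_sym x (z k)).
    by move: zk zy me r2; set q : R := (m.+1%:R^-1)%R; lra.
  have [_ _ /(_ gi x) h _ _] := wP i; exists i => //=.
  have h' : (v0 x <= w i x)%R by apply: h; rewrite ci ri ballEmdist.
  apply: lt_le_trans h'; rewrite /v0.
  have /andP[_ f1] := f01 x.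
  have -> : f x = 1%R by apply/eqP; rewrite eq_le f1.
  by rewrite /del; lra.
- split => // x [i _ /= wi]; apply: (le_trans _ (v_v i x)).
  by rewrite le_max; apply/orP; right; rewrite lerBrDr ltW.
- split => //; first by move=> x; exact: poweR_ge0.
  by apply: (@curve_ug_sup v_ K G) => // x; exact: poweR_ge0.
- have f0 (x : borel X) : (0 <= f x)%R by case/andP: (f01 x).
  have [N [mN N0 mfN]] := completed_modification f0 mf.
  pose fN (x : borel X) := (f x * \1_(~` N) x)%R.
  (* Off [W] no lowered potential exceeds [v0], so [v = v0]; on [W], which has small measure, the
     bound [v <= K] is enough. *)
  pose W := N `|` \bigcup_i B i.
  have mW : measurable (W : set (borel X)).
    by apply: measurableU => //; exact: bigcupT_measurable.
  have muW : mu W <= eta%:E.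
    have mBB : measurable (\bigcup_i B i : set (borel X)) by exact: bigcupT_measurable.
    apply: (@le_trans _ _ (mu N + mu (\bigcup_i B i))); first exact: measureU2.
    rewrite N0 add0e.
    apply: le_trans (epsilon_trick0 predT (ltW eta0)).
    apply: (@le_trans _ _ (\sum_(i <oo) mu (B i))).
      exact: measure_sigma_subadditive.
    by apply: lee_nneseries => // i _; case: (wP i) => _ _ _ _ [].
  have fN0 x : 0 <= (fN x)%:E by rewrite lee_fin mulr_ge0//; case/andP: (f01 x).
  have mfNp : measurable_fun [set: borel X] (fun x => (fN x)%:E `^ p).
    by apply: mpow; apply/measurable_EFinP.
  apply: (@le_trans _ _ (\int[mu]_x ((K `^ p)%:E * (fN x)%:E `^ p + (K `^ p * \1_W x)%:E))).
    apply: ge0_le_integral_nonmeasurable => x; first exact: poweR_ge0.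
    have h0 : 0 <= (K `^ p)%:E * (fN x)%:E `^ p by rewrite mule_ge0 ?poweR_ge0.
    have [Wx|nWx] := pselect (W x).
      rewrite indicE mem_set// mulr1; apply: le_trans (leeDr _ h0).
      by rewrite poweR_EFin lee_fin ge0_ler_powR// ?nnegrE// ltW.
    have fNE : fN x = f x.
      by rewrite /fN indicE mem_set ?mulr1// => Nx; apply: nWx; left.
    have -> : (K `^ p)%:E * (fN x)%:E `^ p = (v0 x)%:E `^ p.
      by rewrite fNE /v0 EFinM poweRM// lee_fin ?f0// ltW.
    rewrite indicE memNset// mulr0 adde0; apply: le_poweR; first exact: ltW.
      by rewrite lee_fin.
    rewrite lee_fin.
    apply: ge_sup; first by exists (v_ 0%N x), 0%N.
    move=> _ [i _ <-]; rewrite ge_max lexx lerBlDr/=.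
    by have [_ _ _ h _] := wP i; apply: h => Bx; apply: nWx; right; exists i.
  have h1 (x : borel X) : 0 <= (K `^ p)%:E * (fN x)%:E `^ p.
    by rewrite mule_ge0 ?poweR_ge0.
  have h2 (x : borel X) : 0 <= (K `^ p * \1_W x)%:E by rewrite lee_fin mulr_ge0.
  have mh1 : measurable_fun [set: borel X] (fun x => (K `^ p)%:E * (fN x)%:E `^ p).
    exact: (measurable_funeM _ mfNp).
  have mh2 : measurable_fun [set: borel X] (fun x => (K `^ p * \1_W x)%:E).
    by apply/measurable_EFinP; apply: measurable_funM => //; exact: measurable_indic.
  rewrite ge0_integralD// ge0_integralZl//; last first.
    by move=> x _; exact: poweR_ge0.
  apply: leeD.
    rewrite lee_wpmul2l ?lee_fin//; apply: ge0_le_integral_nonmeasurable => x.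
      exact: poweR_ge0.
    apply: le_poweR => //; first exact: ltW.
    by rewrite lee_fin /fN ler_piMr.
  under eq_integral do rewrite EFinM.
  rewrite ge0_integralZl//; last by apply/measurable_EFinP; exact: measurable_indic.
  rewrite integral_indic// setIT; apply: (@le_trans _ _ ((K `^ p)%:E * eta%:E)).
    by rewrite lee_wpmul2l ?lee_fin.
  rewrite -EFinM lee_fin /eta mulrCA ger_pMr// ler_pdivrMr ?ltr_wpDl// mul1r.
  by rewrite lerDl.
- under eq_integral do rewrite poweRVK//.
  rewrite ge0_integralD//; last 2 first.
  - by move=> x _; exact: poweR_ge0.
  - exact: mpow.
  rewrite intg1 leeD2l// integral_nneseries//.
  apply: (@le_trans _ _ eta%:E); last first.
    by rewrite lee_fin ler_pdivrMr ?ltr_wpDl// ler_pMr// lerDr.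
  apply: le_trans (epsilon_trick0 predT (ltW eta0)).
  apply: lee_nneseries => [i _ _|i _]; first exact: integral_ge0.
  rewrite (_ : \int[mu]_x s i x = \int[mu]_(x in B i) G_ i x `^ p).
    by case: (wP i) => _ _ _ _ [].
  rewrite [RHS]integral_mkcond; apply: eq_integral => x _.
  rewrite /s patchE indicE; case: ifP => _; first by rewrite mule1.
  by rewrite mule0.
Qed.

End OpenEnlargement.

(** * Capacity *)

Section Capacity.
Context {R : realType} {X : pmetricType R}.
Variables (mu : {measure set (borel X) -> \bar R}) (p : R).
Local Open Scope ereal_scope.
Hypothesis p_gt0 : (0 < p)%R.

Lemma newtonian_norm_pow (u : X -> \bar R) : newtonian_norm mu p u `^ p =
  \int[mu]_x `|u x| `^ p +
  ereal_inf [set \int[mu]_x `|g x| `^ p | g in upper_gradients u].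
Proof.
have normE (h : X -> \bar R) : Lnorm mu p%:E h `^ p = \int[mu]_x `|h x| `^ p.
  by rewrite poweR_Lnorm// gt_eqF.
rewrite /newtonian_norm poweRVK//; last first.
  apply: adde_ge0; first exact: poweR_ge0.
  by apply: le_ereal_inf_tmp => _ [g _ <-]; exact: poweR_ge0.
rewrite normE; congr (_ + ereal_inf _).
by apply/seteqP; split => _ [g ug <-]; exists g => //; rewrite normE.
Qed.

Lemma Lnorm_lty (u : X -> \bar R) :
  (Lnorm mu p%:E u < +oo) = (\int[mu]_x `|u x| `^ p < +oo).
Proof.
rewrite -poweR_Lnorm ?gt_eqF//; apply/idP/idP => [|h]; first exact: poweR_lty.
by apply: lty_poweRy h; rewrite gt_eqF.
Qed.

Lemma le_Cap (E F : set X) : E `<=` F -> Cap mu p E <= Cap mu p F.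
Proof.
move=> EF; apply: le_ereal_inf => _ [u [nu uF] <-]; exists u => //.
by split => // x /EF; exact: uF.
Qed.

Lemma Cap_le (O : set X) (v : X -> R) (G : X -> \bar R) :
  (forall x, 0 <= v x)%R -> (forall x, O x -> (1 <= v x)%R) ->
  (forall a : R, completed_algebra_gen mu [set x | (a < v x)%R]) ->
  measurable_fun [set: borel X] G -> (forall x, 0 <= G x) -> curve_ug v G ->
  \int[mu]_x (v x)%:E `^ p < +oo -> \int[mu]_x G x `^ p < +oo ->
  Cap mu p O <= \int[mu]_x (v x)%:E `^ p + \int[mu]_x G x `^ p.
Proof.
move=> v0 v1 mv mG G0 ug vp Gp.
have absv : \int[mu]_x `|(v x)%:E| `^ p = \int[mu]_x (v x)%:E `^ p.
  by apply: eq_integral => x _; rewrite gee0_abs// lee_fin.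
have absG : \int[mu]_x `|G x| `^ p = \int[mu]_x G x `^ p.
  by apply: eq_integral => x _; rewrite gee0_abs.
have uG := curve_ug_upper_gradients mG G0 ug.
apply: (@le_trans _ _ (newtonian_norm mu p (fun x => (v x)%:E) `^ p)).
  apply: ereal_inf_lbound; exists (fun x => (v x)%:E) => //; split.
    split; first split.
    - by apply: completed_fun => a; exact: mv.
    - by rewrite Lnorm_lty absv.
    exists G => //; split; last by rewrite Lnorm_lty absG.
    move=> Y mY; apply: completed_measurable.
    by have := mG measurableT Y mY; rewrite setTI.
  by move=> x Ox; rewrite lee_fin v1.
rewrite newtonian_norm_pow absv leeD2l//; apply: ereal_inf_lbound.
by exists G.
Qed.

End Capacity.

(** * Truncation to [0, 1] *)

Section Truncation.
Context {R : realType} {X : pmetricType R}.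
Local Open Scope ereal_scope.

Definition truncate (y : \bar R) : R := fine (maxe 0 (mine 1 y)).

Lemma truncateE (y : \bar R) : (truncate y)%:E = maxe 0 (mine 1 y).
Proof.
rewrite /truncate fineK// ge0_fin_numE ?le_max ?lexx//.
by rewrite gt_max ltry/= gt_min ltry.
Qed.

Lemma truncate01 (y : \bar R) : (0 <= truncate y <= 1)%R.
Proof.
by rewrite -!lee_fin truncateE le_max lexx/= ge_max lee_fin ler01 ge_min lexx.
Qed.

Lemma truncate_ge1 (y : \bar R) : 1 <= y -> truncate y = 1%R.
Proof.
move=> y1; apply: EFin_inj; rewrite truncateE min_l// max_r//.
Qed.

(** If a value is infinite, the right-hand side is [+oo], also for two equal infinities by the
    convention on [+oo - +oo]; finite values are clamped. *)
Lemma truncate_dist (y y' : \bar R) :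
  `|truncate y - truncate y'|%:E <= `|y - y'|.
Proof.
have clampE (r : R) : truncate r%:E = clamp 0 1 r.
  by apply: EFin_inj; rewrite truncateE -EFin_min -EFin_max.
have bound (a b : \bar R) : (`|truncate a - truncate b| <= 1)%R.
  rewrite ler_norml; have /andP[? ?] := truncate01 a; have /andP[? ?] := truncate01 b.
  by apply/andP; split; lra.
case: y y' => [r| |] [r'| |] /=; rewrite ?leey//.
by rewrite !clampE lee_fin clamp_lip.
Qed.

Lemma truncate_gt (a : R) (u : X -> \bar R) : (0 <= a < 1)%R ->
  [set x | (a < truncate (u x))%R] = [set x | a%:E < u x].
Proof.
move=> /andP[a0 a1]; apply/seteqP; split => x /=; rewrite -lte_fin truncateE.
  by rewrite lt_max ltNge lee_fin a0/= lt_min => /andP[].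
by move=> au; rewrite lt_max lt_min au (_ : a%:E < 1) ?orbT.
Qed.

Lemma upper_gradients_truncate (u g : X -> \bar R) : upper_gradients u g ->
  upper_gradients (fun x => (truncate (u x))%:E) g.
Proof.
move=> [mg g0 ug]; split => // c rc; apply: le_trans (ug c rc).
by rewrite -EFinB abse_EFin truncate_dist.
Qed.

Lemma truncate_completed (mu : {measure set (borel X) -> \bar R}) (u : X -> \bar R) :
  mu_measurable mu u ->
  forall a : R, completed_algebra_gen mu [set x | (a < truncate (u x))%R].
Proof.
move=> mu_u a; have [a0|a0] := ltP a 0%R.
  apply: completed_measurable; rewrite (_ : mkset _ = setT)//.
  rewrite -subTset => x _ /=; apply: (lt_le_trans a0).
  by case/andP: (truncate01 (u x)).
have [a1|a1] := ltP a 1%R.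
  rewrite truncate_gt ?a0// -[X in completed_algebra_gen _ X]/(u @^-1` [set y | a%:E < y]).
  apply: mu_u; rewrite (_ : mkset _ = `]a%:E, +oo]%classic).
    exact: emeasurable_itv.
  by apply/seteqP; split => y /=; rewrite in_itv/= leey andbT.
apply: completed_measurable; rewrite (_ : mkset _ = set0)//.
rewrite -subset0 => x /=; rewrite ltNge (le_trans _ a1)//.
by case/andP: (truncate01 (u x)).
Qed.

End Truncation.

(** Monotonicity gives one inequality. For the other, an admissible function for [E] with an almost
    optimal upper gradient is truncated to [[0, 1]] and passed to [open_enlargement], whose open set
    contains [E]. *)
Theorem theorem1p8 (R : realType) (p : R) (X : pmetricType R)
    (mu : {measure set (borel X) -> \bar R})
    (p_ge1 : 1 <= p)
    (X_complete : locally_complete X)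
    (X_separable : separable_space X)
    (mu_ball : forall (x : X) (r : R), 0 < r ->
       (0 < mu (ball x r) /\ mu (ball x r) < +oo)%E)
    (E : set X) :
  Cap mu p E =
  ereal_inf [set Cap mu p O | O in [set O : set X | open O /\ E `<=` O]].
Proof.
have p0 : 0 < p by exact: lt_le_trans p_ge1.
apply/eqP; rewrite eq_le; apply/andP; split.
  by apply: le_ereal_inf_tmp => _ [V [_ EV] <-]; exact: le_Cap.
apply: le_ereal_inf_tmp => _ [u [[[mu_u up] [g0 ug0 [_ g0p]]] uE] <-].
rewrite newtonian_norm_pow//.
set a := (\int[mu]_x _)%E; set b := ereal_inf [set (\int[mu]_x _)%E | g in _].
have a_ge0 : (0 <= a)%E by apply: integral_ge0 => x _; exact: poweR_ge0.
have b_ge0 : (0 <= b)%E.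
  by apply: le_ereal_inf_tmp => _ [g _ <-]; apply: integral_ge0 => x _; exact: poweR_ge0.
have a_fin : a \is a fin_num by rewrite ge0_fin_numE// -Lnorm_lty.
have b_fin : b \is a fin_num.
  rewrite ge0_fin_numE//; rewrite Lnorm_lty// in g0p; apply: le_lt_trans g0p.
  by apply: ereal_inf_lbound; exists g0.
set I := ereal_inf _.
have step (e : R) : 0 < e ->
    (I <= (1 + e)%:E * a + e%:E + ((1 + e)%:E * (b + e%:E) + e%:E))%E.
  move=> e0; have [_ [g ug <-] gb] := lb_ereal_inf_adherent e0 b_fin.
  have [mg g_ge0 _] := ug.
  have gE : (\int[mu]_x `|g x| `^ p = \int[mu]_x g x `^ p)%E.
    by apply: eq_integral => x _; rewrite gee0_abs.
  rewrite gE -/b in gb.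
  have gp : (\int[mu]_x g x `^ p < +oo)%E.
    by apply: (lt_trans gb); rewrite -(fineK b_fin) -EFinD ltry.
  (* The enlargement multiplies energies by the p-th power of [K], which is [1 + e] for this
     choice. *)
  pose K := (1 + e) `^ p^-1.
  have Kp : K `^ p = 1 + e.
    by rewrite /K -powRrM mulVf ?gt_eqF// powRr1// addr_ge0// ltW.
  have K1 : 1 < K.
    rewrite ltNge; apply/negP => K1; have : K `^ p <= 1 `^ p.
      by rewrite ge0_ler_powR ?nnegrE ?powR_ge0// ltW.
    by rewrite Kp powR1 gerDl leNgt e0.
  have ugt := upper_gradients_curve_ug (upper_gradients_truncate ug).
  have mu_fin (x : X) (r : R) : 0 < r -> (mu (ball x r) < +oo)%E.
    by move=> /mu_ball -/(_ x)[].
  have [V [v [G [[oV EV] [v0 v1 mv] [mG G0 ugG] vp Gp]]]] :=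
    open_enlargement X_complete X_separable mu_fin p_ge1 K1 e0
      (fun x => truncate01 (u x)) (truncate_completed mu_u) ugt mg g_ge0 gp.
  have ta : (\int[mu]_x (truncate (u x))%:E `^ p <= a)%E.
    apply: ge0_le_integral_nonmeasurable => x; first exact: poweR_ge0.
    apply: le_poweR; [exact: ltW| |].
      by rewrite lee_fin; case/andP: (truncate01 (u x)).
    rewrite truncateE ge_max abse_ge0/= ge_min; apply/orP; right.
    exact: lee_abs.
  rewrite Kp in vp Gp; have e1 : (0 <= (1 + e)%:E)%E by rewrite lee_fin addr_ge0// ltW.
  have vp' : (\int[mu]_x (v x)%:E `^ p <= (1 + e)%:E * a + e%:E)%E.
    by apply: (le_trans vp); rewrite leeD2r// lee_wpmul2l.
  have Gp' : (\int[mu]_x G x `^ p <= (1 + e)%:E * (b + e%:E) + e%:E)%E.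
    by apply: (le_trans Gp); rewrite leeD2r// lee_wpmul2l// ltW.
  apply: (@le_trans _ _ (Cap mu p V)).
    apply: ereal_inf_lbound; exists V => //; split => // x Ex.
    by apply: EV; rewrite truncate_ge1// uE.
  apply: (le_trans _ (leeD vp' Gp')); apply: Cap_le => //.
  - by apply: (le_lt_trans vp'); rewrite -(fineK a_fin) -EFinM -EFinD ltry.
  - apply: (le_lt_trans Gp'); rewrite lte_add_pinfty ?ltry// lte_mul_pinfty//.
    by rewrite lte_add_pinfty ?ltry// ltey_eq b_fin.
apply/lee_addgt0Pr => d d0.
set a' := fine a; set b' := fine b.
have a'0 : 0 <= a' by exact: fine_ge0.
have b'0 : 0 <= b' by exact: fine_ge0.
(* The total error in [step] is [e * (a' + b' + 3 + e)], at most [e * s] because [e <= 1]. *)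
pose s := a' + b' + 4; have s0 : 0 < s by rewrite ltr_wpDl// addr_ge0.
pose e := Num.min 1 (d / s).
have e0 : 0 < e by rewrite lt_min ltr01 divr_gt0.
have e1 : e <= 1 by rewrite ge_min lexx.
have es : e * s <= d by rewrite -ler_pdivlMr// ge_min lexx orbT.
apply: (le_trans (step e e0)); rewrite -(fineK a_fin) -(fineK b_fin) -/a' -/b'.
rewrite -[leLHS]/(((1 + e) * a' + e + ((1 + e) * (b' + e) + e))%:E).
rewrite -!EFinD lee_fin.
have ee : e * e <= e by rewrite ler_piMl// ltW.
have : a' + b' + e * s <= a' + b' + d by rewrite lerD2l.
by apply: le_trans; rewrite /s; nra.
Qed.
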